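(* Let $K \subset \mathbb{R}^2$ be a convex body. Then there exists a quadrangle $Q \subset \mathbb{R}^2$ with $K \subset Q$ and $$|Q| < (1 - 2.6 \cdot 10^{-7}) \sqrt{2} \, |K|.$$
   Context: A convex body is a compact convex set with non-empty interior. $|\cdot|$ denotes the area (two-dimensional Lebesgue measure). A quadrangle is understood here as the convex hull of at most four points in $\mathbb{R}^2$ (a convex polygon, as a filled region, with at most four sides); it is called proper if it has exactly four vertices. *)

(* Defs.v *)
From HB Require Import structures.
From mathcomp Require Import all_boot all_order all_algebra.
From mathcomp Require Import all_classical all_reals all_analysis.

Set Implicit Arguments.
Unset Strict Implicit.
Unset Printing Implicit Defensive.

Import Order.TTheory GRing.Theory Num.Theory.
Import numFieldNormedType.Exports.

Local Open Scope classical_set_scope.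
Local Open Scope ring_scope.

(* [R^o] rather than [R], so that the product carries both its normed-space
   topology and the [lmodType R] structure required by [convex_set]. *)
Notation plane R := (R^o * R^o)%type.

Definition convex_body (R : realType) (K : set (plane R)) : Prop :=
  [/\ compact K, convex_set K & K° !=set0].

Definition convex_hull (R : realType) (A : set (plane R)) : set (plane R) :=
  smallest (@convex_set R (plane R)) A.

(* Repetitions in [s] are harmless; degenerate hulls (triangles, segments,
   points, the empty set) are allowed. *)
Definition quadrangle (R : realType) (Q : set (plane R)) : Prop :=
  exists2 s : seq (plane R), (size s <= 4)%N & Q = convex_hull [set` s].

(* Compact subsets of the plane are Borel, so on convex bodies and quadrangles
   the product measure agrees with its completion. *)
Definition area (R : realType) (A : set (plane R)) : \bar R :=
  ((@lebesgue_measure R) \x (@lebesgue_measure R))%E A.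

(* Main.v *)
(* Let [Q] be a circumscribed quadrangle of minimal area.  Either [K] is a triangle
   equal to [Q], or [K] contains the midpoint of each side of [Q], since otherwise
   that side could be turned so as to reduce the area.  The midpoints form a
   parallelogram of half the area of [Q], which an affine map carries to the square
   [-1, 1]^2, so that [Q] has area 8.  The bounding box of [K] is W x H with W H >= 8
   by minimality, while [K] contains the square and, on each of its sides, a triangle
   reaching the box; hence |K| >= W + H >= 4 sqrt 2 = |Q| / sqrt 2.
   If this is nearly an equality, then W and H are close to 2 sqrt 2, and [K] is close
   to the octagon spanned by the corners of the square and the points where it touches
   the box.  Tilting a side of the box gives another circumscribed quadrangle, and its
   area forces each touching point to be nearly at the middle of its side of the box.
   Four alternate edges of the octagon then span a pinwheel-shaped quadrangle which,
   after a slight enlargement, contains [K] and has area less than 8. *)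

Require Import Defs.
From HB Require Import structures.
From mathcomp Require Import all_boot all_order all_algebra.
From mathcomp Require Import all_classical all_reals all_analysis.
From mathcomp Require Import ring lra.

Set Implicit Arguments.
Unset Strict Implicit.
Unset Printing Implicit Defensive.

Import Order.TTheory GRing.Theory Num.Theory.
Import numFieldNormedType.Exports.
Local Open Scope classical_set_scope.
Local Open Scope ring_scope.

(** The geometry is polynomial algebra over an ordered field: sides are determinant inequalities,
    areas are certificates, and compactness and convexity of [K] enter as [attains_max] and
    [separated]. Topology and measure serve only to produce a minimal quadrangle and to compare
    certificates with [area]. A minimum is not immediate, because [0 < quad_det] is not a closed
    condition. The theorem is therefore proved by contradiction: its denial bounds the determinant
    of every circumscribed quadrangle below by a positive constant, and that bound is a closed
    condition. Near equality all errors are linear in the slack eps: 17 eps for the area of the box,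
    30 eps for the touching points, 75 eps for the lines of the pinwheel. The obstacle is that the
    box need not be concentric with the square. If it were pushed far towards one corner, the
    estimate of the pinwheel would fail; convexity of [K] at that corner of the square excludes
    this. What remains has room for eps = 10^-6, more than the stated constant requires. *)

Definition det3 (R : realFieldType) (a b c : R * R) : R :=
  (b.1 - a.1) * (c.2 - a.2) - (b.2 - a.2) * (c.1 - a.1).

(** For [a = b] this is the whole plane, so a repeated vertex imposes no condition. Hence [a != b]
    in [inner_cut], which would otherwise count the same set twice. *)
Definition left_side (R : realFieldType) (a b : R * R) : set (R * R) :=
  [set z | 0 <= det3 a b z].

(* Areas certified by inscribed triangles, glued along lines; they replace the
   Lebesgue measure until it enters through [inner_area_le]. *)
Inductive inner_area (R : realFieldType) : set (R * R) -> R -> Prop :=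
| inner_triangle K a b c : K a -> K b -> K c -> inner_area K (det3 a b c / 2)
| inner_cut K a b c1 c2 : a != b -> inner_area (K `&` left_side a b) c1 ->
    inner_area (K `&` left_side b a) c2 -> inner_area K (c1 + c2).

(* Cross product of the diagonals, i.e. twice the signed area. *)
Definition quad_det (R : realFieldType) (v1 v2 v3 v4 : R * R) : R :=
  (v3.1 - v1.1) * (v4.2 - v2.2) - (v3.2 - v1.2) * (v4.1 - v2.1).

(** The weak turns admit triangles, with a straight angle or a repeated vertex, and persist in
    limits. Four equal vertices satisfy every condition but the last. *)
Record circumscribed (R : realFieldType) (K : set (R * R)) (v1 v2 v3 v4 : R * R) :
    Prop := Circumscribed {
  turn123 : 0 <= det3 v1 v2 v3;
  turn234 : 0 <= det3 v2 v3 v4;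
  turn341 : 0 <= det3 v3 v4 v1;
  turn412 : 0 <= det3 v4 v1 v2;
  side12 : K `<=` left_side v1 v2;
  side23 : K `<=` left_side v2 v3;
  side34 : K `<=` left_side v3 v4;
  side41 : K `<=` left_side v4 v1;
  quad_det_gt0 : 0 < quad_det v1 v2 v3 v4 }.

(* [K] in coordinates where the midpoints of the sides of its minimal quadrangle
   are the corners of [-1, 1]^2; that quadrangle then has area 8, and its sides
   give the supporting lines at the corners. *)
Record normalized (R : realFieldType) (K : set (R * R)) (A : R) : Prop := Normalized {
  cornerTR : K (1, 1);
  cornerTL : K (- 1, 1);
  cornerBL : K (- 1, - 1);
  cornerBR : K (1, - 1);
  supportTR : exists2 p : R * R, 0 < p.1 /\ 0 < p.2 &
    forall z, K z -> p.1 * (z.1 - 1) + p.2 * (z.2 - 1) <= 0;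
  supportTL : exists2 p : R * R, 0 < p.1 /\ 0 < p.2 &
    forall z, K z -> p.1 * (- z.1 - 1) + p.2 * (z.2 - 1) <= 0;
  supportBL : exists2 p : R * R, 0 < p.1 /\ 0 < p.2 &
    forall z, K z -> p.1 * (- z.1 - 1) + p.2 * (- z.2 - 1) <= 0;
  supportBR : exists2 p : R * R, 0 < p.1 /\ 0 < p.2 &
    forall z, K z -> p.1 * (z.1 - 1) + p.2 * (- z.2 - 1) <= 0;
  min_quad : forall v1 v2 v3 v4, circumscribed K v1 v2 v3 v4 ->
    16 <= quad_det v1 v2 v3 v4;
  max_area : forall c, inner_area K c -> c <= A }.

(* The bounding box of [K] exceeds [-1, 1]^2 by [hR], [hT], [hL], [hB], and [K]
   touches its sides at the points with the given free coordinate. *)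
Record extremes (R : realFieldType) (K : set (R * R)) (hR hT hL hB yR xT yL xB : R) :
    Prop := Extremes {
  touchR : K (1 + hR, yR);
  touchT : K (xT, 1 + hT);
  touchL : K (- 1 - hL, yL);
  touchB : K (xB, - 1 - hB);
  boundR : forall z, K z -> z.1 <= 1 + hR;
  boundT : forall z, K z -> z.2 <= 1 + hT;
  boundL : forall z, K z -> - 1 - hL <= z.1;
  boundB : forall z, K z -> - 1 - hB <= z.2 }.

(** * Quarter turns *)

Definition rotate (R : realFieldType) (K : set (R * R)) : set (R * R) :=
  [set z | K (z.2, - z.1)].

Lemma rotateI (R : realFieldType) (K : set (R * R)) a b :
  rotate K `&` left_side a b =
  rotate (K `&` left_side (a.2, - a.1) (b.2, - b.1)).
Proof.
apply/seteqP; split=> z []; rewrite /rotate /left_side /det3 /= => Kz H;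
  split=> //=; lra.
Qed.

Lemma inner_area_rotate (R : realFieldType) (K : set (R * R)) c :
  inner_area (rotate K) c -> inner_area K c.
Proof.
move E : (rotate K) => K' ia; elim: ia K E => {K' c}.
- move=> K' a b c Ka Kb Kc K KE; rewrite -KE in Ka Kb Kc.
  have -> : det3 a b c = det3 (a.2, - a.1) (b.2, - b.1) (c.2, - c.1).
    by rewrite /det3 /=; ring.
  exact: inner_triangle.
- move=> K' a b c1 c2 ab _ IH1 _ IH2 K KE.
  apply: (@inner_cut _ _ (a.2, - a.1) (b.2, - b.1)).
  + apply: contra_neq ab => -[]; case: a b {IH1 IH2} => a1 a2 [b1 b2] /= -> H.
    by rewrite -(opprK a1) H opprK.
  + by apply: IH1; rewrite -KE rotateI.
  + by apply: IH2; rewrite -KE rotateI.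
Qed.

Lemma normalized_rotate (R : realFieldType) (K : set (R * R)) (A : R) :
  normalized K A -> normalized (rotate K) A.
Proof.
case=> c1 c2 c3 c4 [p1 [p10 p11] s1] [p2 [p20 p21] s2] [p3 [p30 p31] s3].
move=> [p4 [p40 p41] s4] mq ma; split; rewrite /rotate /= ?opprK //.
- by exists (p4.2, p4.1) => // z /s4 /=; lra.
- by exists (p1.2, p1.1) => // z /s1 /=; lra.
- by exists (p2.2, p2.1) => // z /s2 /=; lra.
- by exists (p3.2, p3.1) => // z /s3 /=; lra.
- move=> v1 v2 v3 v4 [t1 t2 t3 t4 e1 e2 e3 e4 q].
  have -> : quad_det v1 v2 v3 v4 = quad_det (v1.2, - v1.1) (v2.2, - v2.1)
     (v3.2, - v3.1) (v4.2, - v4.1) by rewrite /quad_det /=; ring.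
  apply: mq; rewrite /det3 /quad_det in t1 t2 t3 t4 q *.
  have rK a b : rotate K `<=` left_side a b ->
      K `<=` left_side (a.2, - a.1) (b.2, - b.1).
    move=> H z Kz; have : left_side a b (- z.2, z.1).
      by apply: H; rewrite /rotate /= opprK -surjective_pairing.
    by rewrite /left_side /det3 /=; lra.
  by split; rewrite ?/det3 ?/quad_det /=; try exact: rK; lra.
- by move=> c /inner_area_rotate /ma.
Qed.

(** The turn is counterclockwise: the bottom becomes the right side and the right side becomes the
    top. Estimates are proved for the top side or for the corner (1, 1) and carried to the others by
    turning. *)
Lemma extremes_rotate (R : realFieldType) (K : set (R * R)) hR hT hL hB yR xT yL xB :
  extremes K hR hT hL hB yR xT yL xB ->
  extremes (rotate K) hB hR hT hL xB (- yR) xT (- yL).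
Proof.
case=> t1 t2 t3 t4 b1 b2 b3 b4; split; rewrite /rotate /= ?opprK //.
- by rewrite opprD.
- by rewrite opprD !opprK.
- by move=> z /b4 /=; lra.
- by move=> z /b1.
- by move=> z /b2 /=; lra.
- by move=> z /b3.
Qed.

(** * Bounding box and caps *)

Section LeftSideSquare.
Variable R : realFieldType.

Lemma left_side_top : left_side (1, 1) (-1, 1) = [set z : R * R | z.2 <= 1].
Proof. by apply/seteqP; split=> z; rewrite /left_side /det3 /=; lra. Qed.

Lemma left_side_topC : left_side (-1, 1) (1, 1) = [set z : R * R | 1 <= z.2].
Proof. by apply/seteqP; split=> z; rewrite /left_side /det3 /=; lra. Qed.

Lemma left_side_bottom : left_side (-1, -1) (1, -1) = [set z : R * R | -1 <= z.2].
Proof. by apply/seteqP; split=> z; rewrite /left_side /det3 /=; lra. Qed.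

Lemma left_side_bottomC : left_side (1, -1) (-1, -1) = [set z : R * R | z.2 <= -1].
Proof. by apply/seteqP; split=> z; rewrite /left_side /det3 /=; lra. Qed.

Lemma left_side_right : left_side (1, -1) (1, 1) = [set z : R * R | z.1 <= 1].
Proof. by apply/seteqP; split=> z; rewrite /left_side /det3 /=; lra. Qed.

Lemma left_side_rightC : left_side (1, 1) (1, -1) = [set z : R * R | 1 <= z.1].
Proof. by apply/seteqP; split=> z; rewrite /left_side /det3 /=; lra. Qed.

Lemma left_side_left : left_side (-1, 1) (-1, -1) = [set z : R * R | -1 <= z.1].
Proof. by apply/seteqP; split=> z; rewrite /left_side /det3 /=; lra. Qed.

Lemma left_side_leftC : left_side (-1, -1) (-1, 1) = [set z : R * R | z.1 <= -1].
Proof. by apply/seteqP; split=> z; rewrite /left_side /det3 /=; lra. Qed.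

Lemma left_side_diag : left_side (-1, -1) (1, 1) = [set z : R * R | z.1 <= z.2].
Proof. by apply/seteqP; split=> z; rewrite /left_side /det3 /=; lra. Qed.

Lemma left_side_diagC : left_side (1, 1) (-1, -1) = [set z : R * R | z.2 <= z.1].
Proof. by apply/seteqP; split=> z; rewrite /left_side /det3 /=; lra. Qed.

End LeftSideSquare.

Lemma support_le0 (R : realFieldType) (p q a b : R) :
  0 < p /\ 0 < q -> p * a + q * b <= 0 -> 0 <= a -> b <= 0.
Proof.
case=> p0 q0 H a0; have := mulr_ge0 (ltW p0) a0 => pa.
by rewrite -(pmulr_rle0 _ q0); lra.
Qed.

Lemma support_le0l (R : realFieldType) (p q a b : R) :
  0 < p /\ 0 < q -> p * a + q * b <= 0 -> 0 <= b -> a <= 0.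
Proof. by case=> p0 q0; rewrite addrC; apply: support_le0. Qed.

(** The square has area 4, and the triangle from a side of the square to the touching point beyond
    it has base 2 and height [h], hence area [h]. What lies above the square is left as a parameter:
    [area_caps] puts one triangle there, [area_caps_triangle] two. *)
Lemma inner_area_caps (R : realFieldType) (K : set (R * R)) (A : R)
    hR hT hL hB yR xT yL xB c :
  normalized K A -> extremes K hR hT hL hB yR xT yL xB ->
  inner_area (K `&` [set z | 1 <= z.2]) c ->
  inner_area K (4 + hR + hL + hB + c).
Proof.
case=> c1 c2 c3 c4 [p1 p1P s1] [p2 p2P s2] [p3 p3P s3].
move=> [p4 p4P s4] _ _ [t1 t2 t3 t4 b1 b2 b3 b4] iac.
have hR0 : 0 <= hR by have := b1 _ c1; rewrite /=; lra.
have hT0 : 0 <= hT by have := b2 _ c1; rewrite /=; lra.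
have hL0 : 0 <= hL by have := b3 _ c2; rewrite /=; lra.
have hB0 : 0 <= hB by have := b4 _ c4; rewrite /=; lra.
(* By the supporting lines at the corners, each touching point lies between the two corners of its
   side, so the cuts along the other sides do not remove it. *)
have yR1 : yR <= 1 by have /= := support_le0 p1P (s1 _ t1); lra.
have yR2 : -1 <= yR by have /= := support_le0 p4P (s4 _ t1); lra.
have yL1 : yL <= 1 by have /= := support_le0 p2P (s2 _ t3); lra.
have yL2 : -1 <= yL by have /= := support_le0 p3P (s3 _ t3); lra.
have xB1 : xB <= 1 by have /= := support_le0l p4P (s4 _ t4); lra.
have xB2 : -1 <= xB by have /= := support_le0l p3P (s3 _ t4); lra.
have n11 : (-1 : R) != 1 by lra.
have m1 : (-1 : R) <= 1 by lra.
have [rR rL rB] : [/\ 1 <= 1 + hR, -1 - hL <= -1 & -1 - hB <= -1] by split; lra.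
have -> : 4 + hR + hL + hB + c = (((2 + 2) + hL) + hR + hB) + c by ring.
apply: (@inner_cut _ _ (1, 1) (-1, 1)).
- by rewrite xpair_eqE negb_and eq_sym n11.
2: by rewrite left_side_topC.
rewrite left_side_top; apply: (@inner_cut _ _ (-1, -1) (1, -1)).
- by rewrite xpair_eqE negb_and n11.
2: have -> : hB = det3 (-1, -1) (xB, -1 - hB) (1, -1) / 2 by rewrite /det3 /=; field.
2: by rewrite left_side_bottomC; apply: inner_triangle; do 3?split=> //=; apply: le_trans m1.
rewrite left_side_bottom; apply: (@inner_cut _ _ (1, -1) (1, 1)).
- by rewrite xpair_eqE negb_and n11 orbT.
2: have -> : hR = det3 (1, -1) (1 + hR, yR) (1, 1) / 2 by rewrite /det3 /=; field.
2: by rewrite left_side_rightC; apply: inner_triangle; do 4?split=> //=.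
rewrite left_side_right; apply: (@inner_cut _ _ (-1, 1) (-1, -1)).
- by rewrite xpair_eqE negb_and eq_sym n11 orbT.
2: have -> : hL = det3 (-1, 1) (-1 - hL, yL) (-1, -1) / 2 by rewrite /det3 /=; field.
2: by rewrite left_side_leftC; apply: inner_triangle; do 5?split=> //=; apply: le_trans m1.
rewrite left_side_left; apply: (@inner_cut _ _ (-1, -1) (1, 1)).
- by rewrite xpair_eqE negb_and n11.
- rewrite [X in inner_area _ X](_ : _ = det3 (-1, -1) (1, 1) (-1, 1) / 2);
    last by rewrite /det3 /=; field.
  rewrite left_side_diag; apply: inner_triangle; do 6?split=> //=.
- rewrite [X in inner_area _ X](_ : _ = det3 (-1, -1) (1, -1) (1, 1) / 2);
    last by rewrite /det3 /=; field.
  rewrite left_side_diagC; apply: inner_triangle; do 6?split=> //=.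
Qed.

Lemma area_caps (R : realFieldType) (K : set (R * R)) (A : R)
    hR hT hL hB yR xT yL xB :
  normalized K A -> extremes K hR hT hL hB yR xT yL xB ->
  4 + hR + hL + hB + hT <= A.
Proof.
move=> nK eK; apply: (max_area nK); apply: (inner_area_caps nK eK).
have hT0 : 0 <= hT by have := boundT eK (cornerTR nK); rewrite /=; lra.
have -> : hT = det3 (1, 1) (xT, 1 + hT) (-1, 1) / 2 by rewrite /det3 /=; field.
apply: inner_triangle; split; rewrite /= ?lerDl //.
- exact: cornerTR nK.
- exact: touchT eK.
- exact: cornerTL nK.
Qed.

(* Beyond the line from the touching point at the top to the corner (1, 1), the
   set [K] can only add a triangle of area at most the slack in [area_caps]. *)
Lemma area_caps_triangle (R : realFieldType) (K : set (R * R)) (A : R)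
    hR hT hL hB yR xT yL xB z :
  normalized K A -> extremes K hR hT hL hB yR xT yL xB -> K z ->
  (1 - xT) * (z.2 - 1) + hT * (z.1 - 1) <= 2 * (A - (4 + hR + hL + hB + hT)).
Proof.
move=> nK eK Kz.
have e0 := area_caps nK eK.
have hT0 : 0 <= hT by have := boundT eK (cornerTR nK); rewrite /=; lra.
have [p [p0 p1] s1] := supportTR nK.
have sz := s1 _ Kz; have st := s1 _ (touchT eK); rewrite /= in st.
have xT1 : xT <= 1 by nra.
(* A point not above the top side of the square is never beyond the chord from the touching point to
   (1, 1): to the right of that corner this holds because the supporting line there is at least as
   steep as the chord. *)
have [z1|z1] := lerP z.2 1.
  apply: le_trans (_ : _ <= 0) _; last by lra.
  by have [z2|z2] := lerP z.1 1; nra.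
have z2 : z.1 <= 1 by nra.
have [N0|N0] := lerP ((1 - xT) * (z.2 - 1) + hT * (z.1 - 1)) 0; first by lra.
suff : 4 + hR + hL + hB + (((1 - xT) * (z.2 - 1) + hT * (z.1 - 1)) / 2 + hT) <= A.
  by lra.
apply: (max_area nK); apply: (inner_area_caps nK eK).
have z1' := ltW z1; apply: (@inner_cut _ _ (xT, 1 + hT) (1, 1)).
- by apply: contraTneq N0 => -[-> H]; rewrite -leNgt subrr mul0r add0r; nra.
- have -> : (1 - xT) * (z.2 - 1) + hT * (z.1 - 1) = det3 (xT, 1 + hT) (1, 1) z.
    by rewrite /det3 /=; ring.
  by apply: inner_triangle; (split; [split=> //=; rewrite ?lerDl //|
    rewrite /left_side /det3 /=; lra]); [exact: touchT eK|exact: cornerTR nK].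
- have -> : hT = det3 (1, 1) (xT, 1 + hT) (-1, 1) / 2 by rewrite /det3 /=; field.
  by apply: inner_triangle; (split; [split=> //=; rewrite ?lerDl //|
    rewrite /left_side /det3 /=; lra]); [exact: cornerTR nK|exact: touchT eK|
    exact: cornerTL nK].
Qed.

Definition reflect_set (R : realFieldType) (K : set (R * R)) : set (R * R) :=
  [set z | K (- z.1, z.2)].

Lemma inner_area_reflect (R : realFieldType) (K : set (R * R)) c :
  inner_area (reflect_set K) c -> inner_area K c.
Proof.
move E : (reflect_set K) => K' ia; elim: ia K E => {K' c}.
- move=> K' a b c Ka Kb Kc K KE; rewrite -KE in Ka Kb Kc.
  have -> : det3 a b c = det3 (- a.1, a.2) (- c.1, c.2) (- b.1, b.2).
    by rewrite /det3 /=; ring.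
  exact: inner_triangle.
- move=> K' a b c1 c2 ab _ IH1 _ IH2 K KE.
  have refI u v : reflect_set K `&` left_side u v =
      reflect_set (K `&` left_side (- v.1, v.2) (- u.1, u.2)).
    apply/seteqP; split=> z []; rewrite /reflect_set /left_side /det3 /= => Kz H;
      split=> //=; lra.
  apply: (@inner_cut _ _ (- b.1, b.2) (- a.1, a.2)).
  + apply: contra_neq ab => -[]; case: a b {IH1 IH2} => a1 a2 [b1 b2] /= H ->.
    by rewrite -(opprK a1) -H opprK.
  + by apply: IH1; rewrite -KE refI.
  + by apply: IH2; rewrite -KE refI.
Qed.

Lemma normalized_reflect (R : realFieldType) (K : set (R * R)) (A : R) :
  normalized K A -> normalized (reflect_set K) A.
Proof.
case=> c1 c2 c3 c4 [p1 [p10 p11] s1] [p2 [p20 p21] s2] [p3 [p30 p31] s3].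
move=> [p4 [p40 p41] s4] mq ma; split; rewrite /reflect_set /= ?opprK //.
- by exists p2 => // z /s2 /=; lra.
- by exists p1 => // z /s1 /=; lra.
- by exists p4 => // z /s4 /=; lra.
- by exists p3 => // z /s3 /=; lra.
- move=> v1 v2 v3 v4 [t1 t2 t3 t4 e1 e2 e3 e4 q].
  have -> : quad_det v1 v2 v3 v4 = quad_det (- v4.1, v4.2) (- v3.1, v3.2)
     (- v2.1, v2.2) (- v1.1, v1.2) by rewrite /quad_det /=; ring.
  apply: mq; rewrite /det3 /quad_det in t1 t2 t3 t4 q *.
  have rK a b : reflect_set K `<=` left_side a b ->
      K `<=` left_side (- b.1, b.2) (- a.1, a.2).
    move=> H z Kz; have : left_side a b (- z.1, z.2).
      by apply: H; rewrite /reflect_set /= opprK -surjective_pairing.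
    by rewrite /left_side /det3 /=; lra.
  by split; rewrite ?/det3 ?/quad_det /=; try exact: rK; lra.
- by move=> c /inner_area_reflect /ma.
Qed.

Lemma extremes_reflect (R : realFieldType) (K : set (R * R)) hR hT hL hB yR xT yL xB :
  extremes K hR hT hL hB yR xT yL xB ->
  extremes (reflect_set K) hL hT hR hB yL (- xT) yR (- xB).
Proof.
case=> t1 t2 t3 t4 b1 b2 b3 b4; split; rewrite /reflect_set /= ?opprD ?opprK //.
- by move=> z /b3 /=; lra.
- by move=> z /b2.
- by move=> z /b1 /=; lra.
- by move=> z /b4.
Qed.

(* Replace the top of the bounding box by the line bounding [K] in
   [area_caps_triangle]; the trapezoid obtained also has area at least 8. *)
Lemma tilt_right (R : realFieldType) (K : set (R * R)) (A : R)
    hR hT hL hB yR xT yL xB e :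
  normalized K A -> extremes K hR hT hL hB yR xT yL xB -> xT < 1 ->
  e = A - (4 + hR + hL + hB + hT) ->
  (2 + hL + hR) * (hT * ((hR - hL) / 2 - xT) - 2 * e) <=
    ((2 + hL + hR) * (2 + hB + hT) - 8) * (1 - xT).
Proof.
move=> nK eK xT1 eE; have e0 := area_caps nK eK.
have tri z (Kz : K z) := area_caps_triangle nK eK Kz.
rewrite -eE in tri; have {eE}e0 : 0 <= e by lra.
have [mq c1 c3] := And3 (min_quad nK) (cornerTR nK) (cornerBL nK).
case: eK => t1 t2 t3 t4 b1 b2 b3 b4; clear A nK.
have hR0 : 0 <= hR by have := b1 _ c1; rewrite /=; lra.
have hT0 : 0 <= hT by have := b2 _ c1; rewrite /=; lra.
have hL0 : 0 <= hL by have := b3 _ c3; rewrite /=; lra.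
have hB0 : 0 <= hB by have := b4 _ c3; rewrite /=; lra.
have yRB := b4 _ t1; have triR := tri _ t1; rewrite /= in triR yRB.
have [g g0 xTE] : exists2 g, 0 < g & xT = 1 - g by exists (1 - xT); lra.
rewrite {}xTE (_ : 1 - (1 - g) = g) in tri triR *; last by ring.
pose W := 2 + hL + hR; have W0 : 0 < W by rewrite /W; lra.
(* Heights at which the tilted line meets the right and left sides of the box. The right one is
   above the bottom because the touching point on that side lies under the tilted line. *)
pose Yr := 1 + (2 * e - hT * hR) / g; pose Yl := 1 + (2 * e + hT * (2 + hL)) / g.
have YrE : g * (Yr - 1) = 2 * e - hT * hR by rewrite /Yr; field; rewrite gt_eqF.
have YlE : g * (Yl - 1) = 2 * e + hT * (2 + hL) by rewrite /Yl; field; rewrite gt_eqF.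
have YrB : -1 - hB <= Yr.
  apply: le_trans yRB _; rewrite -(ler_pM2l g0); lra.
have YlB : 1 <= Yl.
  rewrite -(ler_pM2l g0).
  have : 0 <= hT * (2 + hL) by apply: mulr_ge0 => //; lra.
  lra.
have cir : circumscribed K (-1 - hL, -1 - hB) (1 + hR, -1 - hB) (1 + hR, Yr)
    (-1 - hL, Yl).
  have WYr : 0 <= W * (Yr + 1 + hB) by apply: mulr_ge0; [exact: ltW | lra].
  have WYl : 0 < W * (Yl + 1 + hB) by apply: mulr_gt0 => //; lra.
  rewrite /W in WYr WYl.
  split; rewrite /det3 /quad_det /=; try lra.
  - move=> z /b4 zB; rewrite /left_side /det3 /=.
    have : 0 <= W * (z.2 + 1 + hB) by apply: mulr_ge0; [exact: ltW | lra].
    by rewrite /W; lra.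
  - move=> z /b1 zR; rewrite /left_side /det3 /=.
    have : 0 <= (Yr + 1 + hB) * (1 + hR - z.1) by apply: mulr_ge0; lra.
    lra.
  - move=> z /tri zT; rewrite /left_side /det3 /= -(pmulr_rge0 _ g0).
    have : 0 <= W * (2 * e - (g * (z.2 - 1) + hT * (z.1 - 1))).
      by apply: mulr_ge0; [exact: ltW | lra].
    congr (_ <= _); symmetry.
    transitivity (- W * (g * (z.2 - 1) - g * (Yr - 1)) -
      (g * (Yl - 1) - g * (Yr - 1)) * (z.1 - (1 + hR))); first by rewrite /W; ring.
    by rewrite YlE YrE /W; ring.
  - move=> z /b3 zL; rewrite /left_side /det3 /=.
    have : 0 <= (Yl + 1 + hB) * (z.1 + 1 + hL) by apply: mulr_ge0; lra.
    lra.
have := mq _ _ _ _ cir; rewrite /quad_det /=.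
rewrite -(ler_pM2l g0).
have -> : g * ((1 + hR - (-1 - hL)) * (Yl - (-1 - hB)) -
     (Yr - (-1 - hB)) * (-1 - hL - (1 + hR))) =
   W * (g * (Yr - 1) + g * (Yl - 1) + g * (4 + 2 * hB)) by rewrite /W; ring.
rewrite YrE YlE /W => H; lra.
Qed.

Lemma box_area (R : realFieldType) (K : set (R * R)) (A : R)
    hR hT hL hB yR xT yL xB :
  normalized K A -> extremes K hR hT hL hB yR xT yL xB ->
  8 <= (2 + hL + hR) * (2 + hB + hT).
Proof.
move=> nK [_ _ _ _ b1 b2 b3 b4].
have [mq c1 c3] := And3 (min_quad nK) (cornerTR nK) (cornerBL nK); clear nK.
have hR0 : 0 <= hR by have := b1 _ c1; rewrite /=; lra.
have hT0 : 0 <= hT by have := b2 _ c1; rewrite /=; lra.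
have hL0 : 0 <= hL by have := b3 _ c3; rewrite /=; lra.
have hB0 : 0 <= hB by have := b4 _ c3; rewrite /=; lra.
pose W := 2 + hL + hR; pose H := 2 + hB + hT.
have [W0 H0] : 0 < W /\ 0 < H by rewrite /W /H; split; lra.
have WH := mulr_gt0 W0 H0.
suff /mq : circumscribed K (-1 - hL, -1 - hB) (1 + hR, -1 - hB) (1 + hR, 1 + hT)
    (-1 - hL, 1 + hT) by rewrite /quad_det /=; lra.
rewrite /W /H in WH.
split; rewrite /det3 /quad_det /=; try lra;
  move=> z Kz; rewrite /left_side /det3 /=.
- have : 0 <= W * (z.2 + 1 + hB).
    by have := b4 _ Kz; move=> ?; apply: mulr_ge0; [exact: ltW | lra].
  by rewrite /W; lra.
- have : 0 <= H * (1 + hR - z.1).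
    by have := b1 _ Kz; move=> ?; apply: mulr_ge0; [exact: ltW | lra].
  by rewrite /H; lra.
- have : 0 <= W * (1 + hT - z.2).
    by have := b2 _ Kz; move=> ?; apply: mulr_ge0; [exact: ltW | lra].
  by rewrite /W; lra.
- have : 0 <= H * (z.1 + 1 + hL).
    by have := b3 _ Kz; move=> ?; apply: mulr_ge0; [exact: ltW | lra].
  by rewrite /H; lra.
Qed.

(** * Stability of the box and of the touching points *)

Lemma near_square (R : realFieldType) (s eps W H A : R) :
  0 <= s -> s ^+ 2 = 2 -> 0 <= eps -> eps <= 1 / 1000 / 1000 ->
  A <= 4 * s * (1 + eps) -> 0 <= W -> 0 <= H -> W + H <= A -> 8 <= W * H ->
  [/\ A - (W + H) <= 6 * eps, W * H <= 8 + 17 * eps,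
      282 / 100 <= W & W <= 284 / 100].
Proof.
move=> s0 s2 eps0 eps1 As W0 H0 WHA WH8.
(* Since 99^2 = 2 * 70^2 + 1, the fractions 99/70 and 140/99 enclose sqrt 2 tightly. *)
have s1 : s <= 99 / 70 by rewrite -(ler_pXn2r (n := 2)) ?nnegrE // ?s2 //; lra.
have s1' : 140 / 99 <= s by rewrite -(ler_pXn2r (n := 2)) ?nnegrE // ?s2 //; lra.
have sq : (W - H) ^+ 2 = (W + H) ^+ 2 - 4 * (W * H) by ring.
(* By AM-GM, [W + H] is at least 4 sqrt 2, so [A] exceeds it by at most 4 sqrt 2 eps. Its square is
   at most 32 (1 + eps)^2, which bounds both [W * H] and [W - H]. *)
have WHs : 4 * s <= W + H.
  rewrite -(ler_pXn2r (n := 2)) ?nnegrE ?addr_ge0 ?mulr_ge0 //.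
  by have := sqr_ge0 (W - H); rewrite sq exprMn s2; clear -WH8; lra.
have s_eps : s * eps <= 99 / 70 * eps by apply: ler_wpM2r.
have WHs2 : (W + H) ^+ 2 <= 32 + 68 * eps.
  apply: (@le_trans _ _ ((4 * s * (1 + eps)) ^+ 2)).
    rewrite ler_pXn2r // ?nnegrE ?addr_ge0 ?mulr_ge0 ?addr_ge0 //.
    exact: le_trans As.
  have -> : (4 * s * (1 + eps)) ^+ 2 = 16 * s ^+ 2 * (1 + 2 * eps + eps * eps).
    by ring.
  have : eps * eps <= 1 / 1000 / 1000 * eps by apply: ler_wpM2r.
  by rewrite s2; clear -eps0; lra.
have WHs3 : W * H <= 8 + 17 * eps.
  by have := sqr_ge0 (W - H); rewrite sq; clear -WHs2; lra.
have WH2 : `|W - H| <= 9 / 1000.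
  have b0 : 0 <= 9 / 1000 :> R by clear; lra.
  rewrite -(@ler_pXn2r _ 2 isT _ _ (normr_ge0 _) b0).
  by rewrite real_normK ?num_real // sq; clear -WHs2 WH8 eps1; lra.
move: WH2; rewrite ler_norml => /andP[WH1 WH2]; split=> //.
- by clear -As WHs s_eps eps0; lra.
- by clear -WHs WH1 s1'; lra.
- by clear -As WHA WH2 s_eps s1 eps1; lra.
Qed.

(** The area of a trapezoid depends only on the height of its slanted side over the middle of the
    base. A chord starting left of the middle is already below the top of the box there, so a large
    displacement would save too much area. As the box is at least 2 wide and [1 - xT <= 2],
    [tilt_right] gives 17 eps + 2 * 6 eps. Only one direction is bounded; reflection gives the
    other. *)
Lemma touch_centred (R : realFieldType) (K : set (R * R)) (A : R)
    hR hT hL hB yR xT yL xB eps :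
  normalized K A -> extremes K hR hT hL hB yR xT yL xB -> 0 <= eps ->
  A - (4 + hR + hL + hB + hT) <= 6 * eps ->
  (2 + hL + hR) * (2 + hB + hT) <= 8 + 17 * eps -> hR <= 1 ->
  hT * ((hR - hL) / 2 - xT) <= 30 * eps.
Proof.
move=> nK eK eps0 e1 t1 hR1.
have [c1 c3] := conj (cornerTR nK) (cornerBL nK).
have hR0 : 0 <= hR by have /= := boundR eK c1; rewrite lerDl.
have hT0 : 0 <= hT by have /= := boundT eK c1; rewrite lerDl.
have hL0 : 0 <= hL by have /= := boundL eK c3; rewrite gerDl oppr_le0.
have xT1 : -1 <= xT.
  have [p pP s2] := supportTL nK.
  by have /= := support_le0l pP (s2 _ (touchT eK)); clear -hT0; lra.
have [xT2|xT2] := ltrP xT 1; last first.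
  apply: (@le_trans _ _ 0); last by rewrite mulr_ge0.
  by apply: mulr_ge0_le0 => //; clear -xT2 hL0 hR1; lra.
have := tilt_right nK eK xT2 erefl.
set e := A - _ in e1 *; set N := hT * _; move: (box_area nK eK).
set WH := (2 + hL + hR) * _ in t1 * => WH8; clear -eps0 e1 t1 hR0 hL0 xT1 xT2 WH8.
have : (WH - 8) * (1 - xT) <= 17 * eps * 2 by apply: ler_pM; lra.
have [N0|N0] := lerP (N - 2 * e) 0; first by lra.
have : 2 * (N - 2 * e) <= (2 + hL + hR) * (N - 2 * e) by rewrite ler_pM2r //; lra.
lra.
Qed.

(** If the touching point is not right of the middle [x] of the box, the chord to (1, 1) is flat
    enough and its slope is taken. Otherwise it is replaced by the slope of the chord from the
    middle; this costs [hT * (xT - x)], at most 30 eps by the reflected [touch_centred]. With the 2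
    * 6 eps of [area_caps_triangle], division by at least 58/100 leaves less than 75 eps. *)
Lemma side_line (R : realFieldType) (K : set (R * R)) (A : R)
    hR hT hL hB yR xT yL xB eps :
  normalized K A -> extremes K hR hT hL hB yR xT yL xB -> 0 <= eps ->
  A - (4 + hR + hL + hB + hT) <= 6 * eps ->
  (2 + hL + hR) * (2 + hB + hT) <= 8 + 17 * eps -> hR <= 84 / 100 -> hL <= 84 / 100 ->
  exists2 s : R, 0 <= s /\ s * (1 - (hR - hL) / 2) <= hT &
    forall z, K z -> (z.2 - 1) + s * (z.1 - 1) <= 75 * eps.
Proof.
move=> nK eK eps0 e1 t1 hR1 hL1.
have [c1 c3] := conj (cornerTR nK) (cornerBL nK).
have hT0 : 0 <= hT by have /= := boundT eK c1; rewrite lerDl.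
have hL0 : 0 <= hL by have /= := boundL eK c3; rewrite gerDl oppr_le0.
have tri z (Kz : K z) := area_caps_triangle nK eK Kz.
have tc : hT * ((hL - hR) / 2 + xT) <= 30 * eps.
  rewrite -[xT]opprK; apply: (touch_centred (normalized_reflect nK)
    (extremes_reflect eK)) => //; clear -e1 t1 hL1; lra.
have bT := boundT eK.
set e := A - _ in e1 tri; set x := (hR - hL) / 2.
have x1 : x <= 42 / 100 by rewrite /x; clear -hR1 hL0; lra.
have {}tc : hT * (xT - x) <= 30 * eps by rewrite /x; clear -tc; lra.
clear -eps0 e1 hT0 tri tc bT x1.
have line g (g0 : 58 / 100 <= g) :
    (forall z, K z -> g * (z.2 - 1) + hT * (z.1 - 1) <= 42 * eps) ->
    forall z, K z -> (z.2 - 1) + hT / g * (z.1 - 1) <= 75 * eps.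
  have g00 : 0 < g by clear -g0; lra.
  move=> H z /H {}H; rewrite -(ler_pM2l g00) mulrDr.
  rewrite (_ : g * (hT / g * (z.1 - 1)) = hT * (z.1 - 1)); last first.
    by field; rewrite gt_eqF.
  have : 58 / 100 * (75 * eps) <= g * (75 * eps) by rewrite ler_wpM2r ?mulr_ge0.
  by clear -H eps0; lra.
have [xx|xx] := lerP xT x.
- exists (hT / (1 - xT)).
    split; first by apply: divr_ge0 => //; clear -xx x1; lra.
    rewrite mulrAC ler_pdivrMr; last by clear -xx x1; lra.
    by apply: ler_wpM2l => //; clear -xx; lra.
  apply: line => [|z /tri]; first by clear -xx x1; lra.
  by clear -e1 eps0; lra.
- exists (hT / (1 - x)).
    split; first by apply: divr_ge0 => //; clear -x1; lra.
    by rewrite divfK // subr_eq0 eq_sym lt_eqF //; clear -x1; lra.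
  apply: line => [|z Kz]; first by clear -x1; lra.
  have := tri _ Kz; have [z1|z1] := lerP 1 z.2.
    have : (xT - x) * (z.2 - 1) <= (xT - x) * hT.
      by apply: ler_wpM2l; have := bT _ Kz; clear -xx; lra.
    by clear -e1 tc; lra.
  have : (xT - x) * (z.2 - 1) <= 0.
    by apply: mulr_ge0_le0; clear -xx z1; lra.
  by clear -e1 eps0; lra.
Qed.

(** The two halves are the coordinates x, y of the centre of the box. Convexity at (1, 1) means
    [hT * hR <= (1 - xT) * (1 - yR)], here up to 12 eps. With touching points at the middles and box
    sides 2 sqrt 2 this becomes x + y <= 2 - sqrt 2, which is below 6/10. For a centre (0.42, 0.42)
    the slopes permitted by [side_line] could add up to more than 2. *)
Lemma corner_sum (R : realFieldType) (K : set (R * R)) (A : R)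
    hR hT hL hB yR xT yL xB eps :
  normalized K A -> extremes K hR hT hL hB yR xT yL xB -> 0 <= eps ->
  eps <= 1 / 1000 / 1000 ->
  A - (4 + hR + hL + hB + hT) <= 6 * eps ->
  (2 + hL + hR) * (2 + hB + hT) <= 8 + 17 * eps ->
  82 / 100 <= hL + hR -> hL + hR <= 84 / 100 ->
  82 / 100 <= hB + hT -> hB + hT <= 84 / 100 ->
  (hR - hL) / 2 + (hT - hB) / 2 <= 6 / 10.
Proof.
move=> nK eK eps0 eps1 e1 t1 W1 W2 H1 H2.
have [c1 c3] := conj (cornerTR nK) (cornerBL nK).
have hR0 : 0 <= hR by have /= := boundR eK c1; rewrite lerDl.
have hT0 : 0 <= hT by have /= := boundT eK c1; rewrite lerDl.
have hL0 : 0 <= hL by have /= := boundL eK c3; rewrite gerDl oppr_le0.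
have hB0 : 0 <= hB by have /= := boundB eK c3; rewrite gerDl oppr_le0.
have := touch_centred nK eK eps0 e1 t1; set x := (hR - hL) / 2 => tT.
have := touch_centred (normalized_reflect (normalized_rotate nK))
  (extremes_reflect (extremes_rotate eK)) eps0.
rewrite opprK; set y := (hT - hB) / 2 => tR.
have {}tT : hT * (x - xT) <= 30 * eps by apply: tT; clear -W2 hL0; lra.
have {}tR : hR * (y - yR) <= 30 * eps.
  by apply: tR; clear -e1 t1 H2 hB0; lra.
have tri := area_caps_triangle nK eK (touchR eK); rewrite /= in tri.
have [p pP s1] := supportTR nK.
have yR1 : yR <= 1.
  by have /= := support_le0 pP (s1 _ (touchR eK)); clear -hR0; lra.
have xT1 : xT <= 1.
  by have /= := support_le0l pP (s1 _ (touchT eK)); clear -hT0; lra.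
set e := A - _ in e1 tri.
have {tri e1 e} : (1 - xT) * (yR - 1) + hT * hR <= 12 * eps by clear -e1 tri; lra.
have [xE yE] : x = (hR + hL) / 2 - hL /\ y = (hT + hB) / 2 - hB.
  by rewrite /x /y; clear; split; lra.
have [xl yl] : 41 / 100 + x <= hR /\ 41 / 100 + y <= hT.
  by rewrite /x /y; clear -W1 H1; split; lra.
have [xu yu] : x <= 42 / 100 /\ y <= 42 / 100.
  by rewrite /x /y; clear -W2 H2 hL0 hB0; split; lra.
have [hRu hTu] : hR <= 84 / 100 /\ hT <= 84 / 100.
  by clear -W2 H2 hL0 hB0; split; lra.
clearbody x y; clear -eps0 eps1 hR0 hT0 tT tR yR1 xT1 xl yl xu yu hRu hTu => tri.
have [//|xy] := lerP; have [x0 y0] : 18 / 100 <= x /\ 18 / 100 <= y by split; lra.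
have PG : hT * hR - (1 - x) * (1 - y) >= 1 / 100.
  have : (41 / 100 + y) * (41 / 100 + x) <= hT * hR.
    by apply: ler_pM; clear -xl yl x0 y0; lra.
  by clear -xy x0 y0; lra.
have P0 : 59 / 100 * (59 / 100) <= hT * hR.
  by apply: ler_pM; clear -xl yl x0 y0; lra.
have P1 : hT * hR <= 84 / 100 * (84 / 100) by apply: ler_pM.
(* Only [hT * (x - xT)] and [hR * (y - yR)] are controlled, so the convexity inequality is
   multiplied by [hT * hR] before [xT] and [yR] are eliminated. *)
have ab : hT * (1 - xT) * (hR * (1 - yR)) <=
    (hT * (1 - x) + 30 * eps) * (hR * (1 - y) + 30 * eps).
  by apply: ler_pM; rewrite ?mulr_ge0 ?subr_ge0 //; [clear -tT|clear -tR]; lra.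
have {tri ab} : (hT * hR) * (hT * hR - (1 - x) * (1 - y)) <=
    30 * eps * (hT * (1 - x) + hR * (1 - y)) + 900 * (eps * eps) +
    12 * eps * (hT * hR).
  have : 0 <= hT * hR * (12 * eps - ((1 - xT) * (yR - 1) + hT * hR)).
    by rewrite !mulr_ge0 // subr_ge0.
  by clear -ab; lra.
have : 1 / 3 * (1 / 100) <= hT * hR * (hT * hR - (1 - x) * (1 - y)).
  by apply: ler_pM; clear -P0 PG; lra.
have : eps * eps <= 1 / 1000 * eps.
  by apply: ler_wpM2r => //; clear -eps1; lra.
have : eps * (hT * hR) <= eps * 1 by apply: ler_wpM2l => //; clear -P1; lra.
have a1 : hT * (1 - x) <= 84 / 100 * 1 by apply: ler_pM; clear -hT0 hTu x0 xu; lra.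
have b1 : hR * (1 - y) <= 84 / 100 * 1 by apply: ler_pM; clear -hR0 hRu y0 yu; lra.
have : eps * (hT * (1 - x) + hR * (1 - y)) <= eps * 2.
  by apply: ler_wpM2l => //; clear -a1 b1; lra.
by clear -eps0 eps1; lra.
Qed.

(** * The pinwheel quadrangle *)

(** Through each corner of the square [-t, t]^2 passes one line, tilted by [p], [q], [r] or [s]. The
    first vertex is (t, -t) + t a (p, 1), and [a * (1 + p * q) = 2] puts it on the line through (t,
    t). The quadrangle is the square plus four triangles of base 2 t and heights t p a, t q b, t r
    c, t s d. *)
Lemma pinwheel_det (R : realFieldType) (t p q r s a b c d : R) :
  a * (1 + p * q) = 2 -> b * (1 + q * r) = 2 -> c * (1 + r * s) = 2 ->
  d * (1 + s * p) = 2 ->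
  quad_det (t * (1 + p * a), t * (a - 1)) (t * (1 - b), t * (1 + q * b))
    (t * (- 1 - r * c), t * (1 - c)) (t * (d - 1), t * (- 1 - s * d)) =
  t ^+ 2 * (8 + 2 * (p * a + q * b + r * c + s * d)).
Proof.
move=> aE bE cE dE; rewrite /quad_det /=.
have apq : a * (p * q) = 2 - a by rewrite -aE; ring.
have bqr : b * (q * r) = 2 - b by rewrite -bE; ring.
have crs : c * (r * s) = 2 - c by rewrite -cE; ring.
have dsp : d * (s * p) = 2 - d by rewrite -dE; ring.
rewrite (_ : _ - _ = t ^+ 2 * ((2 + r * c + p * a) * (2 + s * d + q * b) +
  (2 - a - c) * (2 - b - d))); last by ring.
congr (_ * _).
transitivity (8 + 2 * (p * a + q * b + r * c + s * d) - 2 * (a + b + c + d) +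
  (a + c) * (b + d) + (c * (r * s) * d + c * (b * (q * r)) + a * (d * (s * p)) +
  a * (p * q) * b)); first by ring.
by rewrite apq bqr crs dsp; ring.
Qed.

Lemma circumscribed_pinwheel (R : realFieldType) (K : set (R * R))
    (t p q r s a b c d : R) :
  0 < t -> 0 <= p -> 0 <= q -> 0 <= r -> 0 <= s ->
  0 < a -> 0 < b -> 0 < c -> 0 < d ->
  a * (1 + p * q) = 2 -> b * (1 + q * r) = 2 -> c * (1 + r * s) = 2 ->
  d * (1 + s * p) = 2 ->
  (forall z, K z -> z.2 + q * z.1 <= t * (1 + q)) ->
  (forall z, K z -> - z.1 + r * z.2 <= t * (1 + r)) ->
  (forall z, K z -> - z.2 - s * z.1 <= t * (1 + s)) ->
  (forall z, K z -> z.1 - p * z.2 <= t * (1 + p)) ->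
  circumscribed K (t * (1 + p * a), t * (a - 1)) (t * (1 - b), t * (1 + q * b))
    (t * (- 1 - r * c), t * (1 - c)) (t * (d - 1), t * (- 1 - s * d)).
Proof.
move=> t0 p0 q0 r0 s0 a0 b0 c0 d0 aE bE cE dE kq kr ks kp.
have [pa qb rc sd] : [/\ 0 <= p * a, 0 <= q * b, 0 <= r * c & 0 <= s * d].
  by split; apply: mulr_ge0 => //; apply: ltW.
(* The edge vectors are l1 (-1, q), l2 (-r, -1), l3 (1, -s) and l4 (p, 1), so each turn is a product
   such as l1 l2 (1 + q r). *)
pose l1 := t * (p * a + b); pose l2 := t * (q * b + c).
pose l3 := t * (r * c + d); pose l4 := t * (s * d + a).
have [l10 l20 l30 l40] : [/\ 0 <= l1, 0 <= l2, 0 <= l3 & 0 <= l4].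
  by split; (apply: mulr_ge0; [exact: ltW | apply: addr_ge0 => //; exact: ltW]).
have turn (l l' u v : R) : 0 <= l -> 0 <= l' -> 0 <= u -> 0 <= v ->
    0 <= l * l' * (1 + u * v).
  by move=> *; rewrite !mulr_ge0 ?addr_ge0 ?mulr_ge0.
have apq : a * (p * q) = 2 - a by rewrite -aE; ring.
have bqr : b * (q * r) = 2 - b by rewrite -bE; ring.
have crs : c * (r * s) = 2 - c by rewrite -cE; ring.
have dsp : d * (s * p) = 2 - d by rewrite -dE; ring.
have e1 : t * (1 + q * b) - t * (a - 1) = q * l1.
  by transitivity (t * (a * (p * q) + q * b)); [rewrite apq; ring | rewrite /l1; ring].
have e2 : t * (- 1 - r * c) - t * (1 - b) = - (r * l2).
  by transitivity (- (t * (b * (q * r) + r * c))); [rewrite bqr; ring | rewrite /l2; ring].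
have e3 : t * (- 1 - s * d) - t * (1 - c) = - (s * l3).
  by transitivity (- (t * (c * (r * s) + s * d))); [rewrite crs; ring | rewrite /l3; ring].
have e4 : t * (1 + p * a) - t * (d - 1) = p * l4.
  by transitivity (t * (d * (s * p) + p * a)); [rewrite dsp; ring | rewrite /l4; ring].
have f1 : t * (1 - b) - t * (1 + p * a) = - l1 by rewrite /l1; ring.
have f2 : t * (1 - c) - t * (1 + q * b) = - l2 by rewrite /l2; ring.
have f3 : t * (d - 1) - t * (- 1 - r * c) = l3 by rewrite /l3; ring.
have f4 : t * (a - 1) - t * (- 1 - s * d) = l4 by rewrite /l4; ring.
have det3E (u v w : R * R) : det3 u v w = (v.1 - u.1) * (w.2 - v.2) -
    (v.2 - u.2) * (w.1 - v.1) by rewrite /det3; ring.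
split.
- rewrite det3E /= e1 e2 f1 f2.
  by have := turn _ _ _ _ l10 l20 q0 r0; congr (_ <= _); ring.
- rewrite det3E /= e2 e3 f2 f3.
  by have := turn _ _ _ _ l20 l30 r0 s0; congr (_ <= _); ring.
- rewrite det3E /= e3 e4 f3 f4.
  by have := turn _ _ _ _ l30 l40 s0 p0; congr (_ <= _); ring.
- rewrite det3E /= e4 e1 f4 f1.
  by have := turn _ _ _ _ l40 l10 p0 q0; congr (_ <= _); ring.
- move=> z /kq; rewrite -subr_ge0 => /(mulr_ge0 l10); rewrite /left_side /det3 /=.
  rewrite e1 f1; congr (_ <= _).
  transitivity (l1 * (t * (a - 1) + q * (t * (1 + p * a)) - z.2 - q * z.1)); last by ring.
  congr (l1 * _); transitivity (t * (a + a * (p * q)) - t + t * q - z.2 - q * z.1); last by ring.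
  by rewrite apq; ring.
- move=> z /kr; rewrite -subr_ge0 => /(mulr_ge0 l20); rewrite /left_side /det3 /=.
  rewrite e2 f2; congr (_ <= _).
  transitivity (l2 * (t * (b - 1) + r * (t * (1 + q * b)) + z.1 - r * z.2)); last by ring.
  congr (l2 * _); transitivity (t * (b + b * (q * r)) - t + t * r + z.1 - r * z.2); last by ring.
  by rewrite bqr; ring.
- move=> z /ks; rewrite -subr_ge0 => /(mulr_ge0 l30); rewrite /left_side /det3 /=.
  rewrite e3 f3; congr (_ <= _).
  transitivity (l3 * (t * (c - 1) + s * (t * (1 + r * c)) + z.2 + s * z.1)); last by ring.
  congr (l3 * _); transitivity (t * (c + c * (r * s)) - t + t * s + z.2 + s * z.1); last by ring.
  by rewrite crs; ring.
- move=> z /kp; rewrite -subr_ge0 => /(mulr_ge0 l40); rewrite /left_side /det3 /=.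
  rewrite e4 f4; congr (_ <= _).
  transitivity (l4 * (t * (d - 1) + p * (t * (1 + s * d)) - z.1 + p * z.2)); last by ring.
  congr (l4 * _); transitivity (t * (d + d * (s * p)) - t + t * p - z.1 + p * z.2); last by ring.
  by rewrite dsp; ring.
- rewrite pinwheel_det // mulr_gt0 ?exprn_gt0 //.
  by rewrite ltr_wpDr ?mulr_ge0 ?addr_ge0.
Qed.

(* The bound has to be below 2 to make [pinwheel_det] less than 16. *)
Lemma slope_sum (R : realFieldType) (x y H1 H2 p q r s : R) :
  x <= 42 / 100 -> - x <= 42 / 100 -> y <= 42 / 100 -> - y <= 42 / 100 ->
  x + y <= 6 / 10 -> x - y <= 6 / 10 -> y - x <= 6 / 10 -> - x - y <= 6 / 10 ->
  H1 <= 42 / 100 -> H2 <= 42 / 100 ->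
  q * (1 - x) <= H2 + y -> s * (1 + x) <= H2 - y ->
  p * (1 + y) <= H1 + x -> r * (1 - y) <= H1 - x ->
  p + q + r + s <= 198 / 100.
Proof.
move=> x1 x2 y1 y2 xy1 xy2 xy3 xy4 h1 h2 qh sh ph rh.
pose X := 1 - x ^+ 2; pose Y := 1 - y ^+ 2.
have [X0 Y0] : 0 < X /\ 0 < Y.
  rewrite /X /Y (_ : 1 - x ^+ 2 = (1 - x) * (1 + x)); last by ring.
  rewrite (_ : 1 - y ^+ 2 = (1 - y) * (1 + y)); last by ring.
  by split; apply: mulr_gt0; [clear -x1|clear -x2|clear -y1|clear -y2]; lra.
have qX : q * X <= (H2 + y) * (1 + x).
  rewrite /X (_ : q * _ = q * (1 - x) * (1 + x)); last by ring.
  by apply: ler_wpM2r => //; clear -x2; lra.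
have sX : s * X <= (H2 - y) * (1 - x).
  rewrite /X (_ : s * _ = s * (1 + x) * (1 - x)); last by ring.
  by apply: ler_wpM2r => //; clear -x1; lra.
have pY : p * Y <= (H1 + x) * (1 - y).
  rewrite /Y (_ : p * _ = p * (1 + y) * (1 - y)); last by ring.
  by apply: ler_wpM2r => //; clear -y1; lra.
have rY : r * Y <= (H1 - x) * (1 + y).
  rewrite /Y (_ : r * _ = r * (1 - y) * (1 + y)); last by ring.
  by apply: ler_wpM2r => //; clear -y2; lra.
have {qX sX}qs : (q + s) * X <= 84 / 100 + 2 * x * y.
  by clear -qX sX h2; lra.
have {pY rY}pr : (p + r) * Y <= 84 / 100 - 2 * x * y.
  by clear -pY rY h1; lra.
have {qs}qs : (q + s) * X * Y <= (84 / 100 + 2 * x * y) * Y.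
  by rewrite ler_pM2r.
have {pr}pr : (p + r) * Y * X <= (84 / 100 - 2 * x * y) * X.
  by rewrite ler_pM2r.
rewrite -(ler_pM2r (mulr_gt0 X0 Y0)).
have nxy : `|x| + `|y| <= 6 / 10.
  have [x0|x0] := ger0P x; have [y0|y0] := ger0P y; clear -xy1 xy2 xy3 xy4; lra.
have nx : `|x| <= 42 / 100 by rewrite ler_norml; clear -x1 x2; lra.
have ny : `|y| <= 42 / 100 by rewrite ler_norml; clear -y1 y2; lra.
(* On the region where both absolute values are at most 0.42 and their sum at most 0.6, the maximum
   is 0.2088, reached at points such as (0.42, 0.18). *)
have r2 : x ^+ 2 + y ^+ 2 <= 21 / 100.
  rewrite -(real_normK (num_real x)) -(real_normK (num_real y)).
  move: `|x| `|y| (normr_ge0 x) (normr_ge0 y) nx ny nxy => u v u0 v0 uu vv uv.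
  clear -u0 v0 uu vv uv; have uv0 := mulr_ge0 u0 v0.
  have : 0 <= (42 / 100 - u) * (42 / 100 - v) by rewrite mulr_ge0 ?subr_ge0.
  have [s0|s0] := lerP (u + v) (42 / 100) => uv'.
    have : (u + v) * (u + v) <= 42 / 100 * (42 / 100) by apply: ler_pM; rewrite ?addr_ge0.
    by clear -uv0; lra.
  have : 0 <= (u + v - 42 / 100) * (6 / 10 - (u + v)).
    by rewrite mulr_ge0 ?subr_ge0 // ltW.
  by clear -uv uv'; lra.
(* The squares of 2 x y and x^2 - y^2 add up to (x^2 + y^2)^2, so twice their product is at most
   that. *)
have r4 : 4 * (x * y * (x ^+ 2 - y ^+ 2)) <= 21 / 100 * (21 / 100).
  have : (x ^+ 2 + y ^+ 2) ^+ 2 <= 21 / 100 * (21 / 100).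
    by apply: ler_pM => //; rewrite addr_ge0 ?sqr_ge0.
  have := sqr_ge0 (2 * x * y - (x ^+ 2 - y ^+ 2)); clear; lra.
have xy0 : 0 <= x ^+ 2 * y ^+ 2 by rewrite mulr_ge0 ?sqr_ge0.
rewrite /X /Y in qs pr *; clear -qs pr r2 r4 xy0; lra.
Qed.

Lemma normalized_area_gt (R : realFieldType) (K : set (R * R)) (A s eps : R)
    hR hT hL hB yR xT yL xB :
  normalized K A -> extremes K hR hT hL hB yR xT yL xB ->
  0 <= s -> s ^+ 2 = 2 -> 0 <= eps -> eps <= 1 / 1000 / 1000 ->
  4 * s * (1 + eps) < A.
Proof.
move=> nK eK s0 s2 eps0 eps1; rewrite ltNge; apply/negP => As.
have [c1 c3] := conj (cornerTR nK) (cornerBL nK).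
have hR0 : 0 <= hR by have /= := boundR eK c1; rewrite lerDl.
have hT0 : 0 <= hT by have /= := boundT eK c1; rewrite lerDl.
have hL0 : 0 <= hL by have /= := boundL eK c3; rewrite gerDl oppr_le0.
have hB0 : 0 <= hB by have /= := boundB eK c3; rewrite gerDl oppr_le0.
have WH := area_caps nK eK; have WH8 := box_area nK eK.
have WH' : 2 + hL + hR + (2 + hB + hT) <= A by clear -WH; lra.
have W0 : 0 <= 2 + hL + hR by rewrite !addr_ge0.
have H0 : 0 <= 2 + hB + hT by rewrite !addr_ge0.
have [e1 t1 W1 W2] := near_square s0 s2 eps0 eps1 As W0 H0 WH' WH8.
have AWH : A <= 2 + hB + hT + (2 + hL + hR) + 6 * eps.
  by clear -e1; lra.
have [_ _ H1 H2] : [/\ A - (2 + hB + hT + (2 + hL + hR)) <= 6 * eps,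
    (2 + hB + hT) * (2 + hL + hR) <= 8 + 17 * eps,
    282 / 100 <= 2 + hB + hT & 2 + hB + hT <= 284 / 100].
  by apply: (near_square s0 s2 eps0 eps1 As H0 W0); [rewrite addrC|rewrite mulrC].
clear s s0 s2 As WH WH8 WH' W0 H0 e1.
(* [K] itself gives the slope [q] of the top line; one, two and three turns give [p] on the right,
   [s] at the bottom and [r] on the left. *)
have nK1 := normalized_rotate nK; have eK1 := extremes_rotate eK.
have nK2 := normalized_rotate nK1; have eK2 := extremes_rotate eK1.
have nK3 := normalized_rotate nK2; have eK3 := extremes_rotate eK2.
have side0 := side_line nK eK eps0; have side1 := side_line nK1 eK1 eps0.
have side2 := side_line nK2 eK2 eps0; have side3 := side_line nK3 eK3 eps0.
have cor0 := corner_sum nK eK eps0 eps1; have cor1 := corner_sum nK1 eK1 eps0 eps1.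
have cor2 := corner_sum nK2 eK2 eps0 eps1; have cor3 := corner_sum nK3 eK3 eps0 eps1.
have mq := min_quad nK.
clear nK nK1 nK2 nK3 eK eK1 eK2 eK3 c1 c3.
have {}cor0 : (hR - hL) / 2 + (hT - hB) / 2 <= 6 / 10.
  by apply: cor0; clear -AWH t1 W1 W2 H1 H2; lra.
have {}cor1 : (hB - hT) / 2 + (hR - hL) / 2 <= 6 / 10.
  by apply: cor1; clear -AWH t1 W1 W2 H1 H2; lra.
have {}cor2 : (hL - hR) / 2 + (hB - hT) / 2 <= 6 / 10.
  by apply: cor2; clear -AWH t1 W1 W2 H1 H2; lra.
have {}cor3 : (hT - hB) / 2 + (hL - hR) / 2 <= 6 / 10.
  by apply: cor3; clear -AWH t1 W1 W2 H1 H2; lra.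
have {side0}[q [q0 qh] kq] : exists2 s : R, 0 <= s /\ s * (1 - (hR - hL) / 2) <= hT &
    forall z, K z -> (z.2 - 1) + s * (z.1 - 1) <= 75 * eps.
  by apply: side0; clear -AWH t1 W1 W2 H1 H2 hR0 hL0 hT0 hB0; lra.
have {side1}[p [p0 ph] kp] : exists2 s : R, 0 <= s /\ s * (1 - (hB - hT) / 2) <= hR &
    forall z, rotate K z -> (z.2 - 1) + s * (z.1 - 1) <= 75 * eps.
  by apply: side1; clear -AWH t1 W1 W2 H1 H2 hR0 hL0 hT0 hB0; lra.
have {side2}[s [s0 sh] ks] : exists2 s : R, 0 <= s /\ s * (1 - (hL - hR) / 2) <= hB &
    forall z, rotate (rotate K) z -> (z.2 - 1) + s * (z.1 - 1) <= 75 * eps.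
  by apply: side2; clear -AWH t1 W1 W2 H1 H2 hR0 hL0 hT0 hB0; lra.
have {side3}[r [r0 rh] kr] : exists2 s : R, 0 <= s /\ s * (1 - (hT - hB) / 2) <= hL &
    forall z, rotate (rotate (rotate K)) z -> (z.2 - 1) + s * (z.1 - 1) <= 75 * eps.
  by apply: side3; clear -AWH t1 W1 W2 H1 H2 hR0 hL0 hT0 hB0; lra.
have sum : p + q + r + s <= 198 / 100.
  by apply: (@slope_sum _ ((hR - hL) / 2) ((hT - hB) / 2) ((hR + hL) / 2) ((hT + hB) / 2));
    clear -W1 W2 H1 H2 hR0 hL0 hT0 hB0 cor0 cor1 cor2 cor3 ph qh rh sh; lra.
clear -eps0 eps1 mq p0 q0 r0 s0 kp kq kr ks sum.
(* Each line was raised by 75 eps. Scaling by [t] raises its right-hand side by 75 eps times one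
   plus the slope, hence by at least as much. *)
pose t := 1 + 75 * eps.
have t0 : 0 < t by rewrite ltr_wpDr ?mulr_ge0.
have tD u : 0 <= u -> 1 + u + 75 * eps <= t * (1 + u).
  by move=> u0; have := mulr_ge0 eps0 u0; rewrite /t; lra.
have inv (u v : R) : 0 <= u -> 0 <= v ->
    exists a, [/\ a * (1 + u * v) = 2, 0 < a & a <= 2].
  move=> u0 v0; have D1 : 1 <= 1 + u * v by rewrite lerDl mulr_ge0.
  have D0 := lt_le_trans ltr01 D1.
  exists (2 / (1 + u * v)); split; first by rewrite divfK // gt_eqF.
    by rewrite divr_gt0.
  by rewrite ler_pdivrMr // ler_peMr.
have [a [aE a0 a2]] := inv _ _ p0 q0; have [b [bE b0 b2]] := inv _ _ q0 r0.
have [c [cE c0 c2]] := inv _ _ r0 s0; have [d [dE d0 d2]] := inv _ _ s0 p0.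
have {}kq z : K z -> z.2 + q * z.1 <= t * (1 + q).
  by move=> /kq Kz; apply: le_trans (tD _ q0); clear -Kz; lra.
have {}kp z : K z -> z.1 - p * z.2 <= t * (1 + p).
  move=> Kz; have /= Kz' : z.1 - 1 + p * (- z.2 - 1) <= 75 * eps.
    by apply: (kp (- z.2, z.1)); rewrite /rotate /= opprK -surjective_pairing.
  by apply: le_trans (tD _ p0); clear -Kz'; lra.
have {}ks z : K z -> - z.2 - s * z.1 <= t * (1 + s).
  move=> Kz; have /= Kz' : - z.2 - 1 + s * (- z.1 - 1) <= 75 * eps.
    by apply: (ks (- z.1, - z.2)); rewrite /rotate /= !opprK -surjective_pairing.
  by apply: le_trans (tD _ s0); clear -Kz'; lra.
have {}kr z : K z -> - z.1 + r * z.2 <= t * (1 + r).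
  move=> Kz; have /= Kz' : - z.1 - 1 + r * (z.2 - 1) <= 75 * eps.
    by apply: (kr (z.2, - z.1)); rewrite /rotate /= !opprK -surjective_pairing.
  by apply: le_trans (tD _ r0); clear -Kz'; lra.
have := mq _ _ _ _ (circumscribed_pinwheel t0 p0 q0 r0 s0 a0 b0 c0 d0 aE bE cE dE
  kq kr ks kp).
rewrite pinwheel_det //; apply/negP; rewrite -ltNge.
have [pa qb rc sd] : [/\ p * a <= p * 2, q * b <= q * 2, r * c <= r * 2 & s * d <= s * 2].
  by split; apply: ler_wpM2l.
have t2 : t ^+ 2 <= 1001 / 1000.
  have : eps * eps <= 1 / 1000 / 1000 * eps by apply: ler_wpM2r.
  by rewrite /t; clear -eps0 eps1; lra.
(* 396/100 is twice the bound on the sum of the slopes, as [a], [b], [c], [d] are at most 2. The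
   value is about 15.94, while minimality demands 16. *)
apply: (@le_lt_trans _ _ (1001 / 1000 * (8 + 2 * (396 / 100)))); last by clear; lra.
apply: ler_pM => //; first by rewrite exprn_ge0 // ltW.
  by rewrite addr_ge0 ?mulr_ge0 ?addr_ge0 ?mulr_ge0 // ltW.
by clear -pa qb rc sd sum; lra.
Qed.

(** * Affine normalization *)

Section Frame.
Variables (R : realFieldType) (o e1 e2 : R * R).

Definition frame_point (z : R * R) : R * R :=
  (o.1 + z.1 * e1.1 + z.2 * e2.1, o.2 + z.1 * e1.2 + z.2 * e2.2).

Definition in_frame (K : set (R * R)) : set (R * R) := [set z | K (frame_point z)].

Let D := e1.1 * e2.2 - e1.2 * e2.1.
Hypothesis D0 : 0 < D.

Lemma det3_frame a b c :
  det3 (frame_point a) (frame_point b) (frame_point c) = D * det3 a b c.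
Proof. by rewrite /det3 /D /=; ring. Qed.

Lemma quad_det_frame a b c d :
  quad_det (frame_point a) (frame_point b) (frame_point c) (frame_point d) =
  D * quad_det a b c d.
Proof. by rewrite /quad_det /D /=; ring. Qed.

Lemma in_frame_left_side K a b : in_frame K `&` left_side a b =
  in_frame (K `&` left_side (frame_point a) (frame_point b)).
Proof.
by apply/seteqP; split=> z []; rewrite /in_frame /left_side /= => Kz;
  rewrite det3_frame pmulr_rge0.
Qed.

Lemma frame_point_surj u : frame_point
  (((u.1 - o.1) * e2.2 - (u.2 - o.2) * e2.1) / D,
   (e1.1 * (u.2 - o.2) - e1.2 * (u.1 - o.1)) / D) = u.
Proof.
have Dn : D != 0 by rewrite gt_eqF.
rewrite [RHS]surjective_pairing /frame_point /=; congr (_, _); rewrite /D in Dn *.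
  by field.
by field.
Qed.

Lemma frame_point_inj : injective frame_point.
Proof.
have Dn : D != 0 by rewrite gt_eqF.
move=> [a1 a2] [b1 b2]; rewrite /frame_point /= => -[E1 E2].
have H1 : a1 * e1.1 + a2 * e2.1 = b1 * e1.1 + b2 * e2.1 by lra.
have H2 : a1 * e1.2 + a2 * e2.2 = b1 * e1.2 + b2 * e2.2 by lra.
congr (_, _); apply: (mulIf Dn).
  transitivity ((a1 * e1.1 + a2 * e2.1) * e2.2 - (a1 * e1.2 + a2 * e2.2) * e2.1).
    by rewrite /D; ring.
  by rewrite H1 H2 /D; ring.
transitivity ((a1 * e1.2 + a2 * e2.2) * e1.1 - (a1 * e1.1 + a2 * e2.1) * e1.2).
  by rewrite /D; ring.
by rewrite H1 H2 /D; ring.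
Qed.

Lemma inner_area_frame K c : inner_area (in_frame K) c -> inner_area K (D * c).
Proof.
move E : (in_frame K) => K' ia; elim: ia K E => {K' c}.
- move=> K' a b c Ka Kb Kc K KE; rewrite -KE in Ka Kb Kc.
  by rewrite mulrA -det3_frame; apply: inner_triangle.
- move=> K' a b c1 c2 ab _ IH1 _ IH2 K KE; rewrite mulrDr.
  apply: (@inner_cut _ _ (frame_point a) (frame_point b)).
  + by rewrite (inj_eq frame_point_inj).
  + by apply: IH1; rewrite -KE in_frame_left_side.
  + by apply: IH2; rewrite -KE in_frame_left_side.
Qed.

Lemma circumscribed_frame K a b c d : circumscribed (in_frame K) a b c d ->
  circumscribed K (frame_point a) (frame_point b) (frame_point c) (frame_point d).
Proof.
have side u v : in_frame K `<=` left_side u v ->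
    K `<=` left_side (frame_point u) (frame_point v).
  move=> H z; rewrite -(frame_point_surj z) => /H.
  by rewrite /left_side /= det3_frame pmulr_rge0.
case=> t1 t2 t3 t4 s1 s2 s3 s4 q.
by split; rewrite ?det3_frame ?quad_det_frame ?pmulr_rge0 ?pmulr_rgt0 //; exact: side.
Qed.

End Frame.

(** What compactness contributes to the algebraic part: extreme points in every direction, stated
    without topology. *)
Definition attains_max (R : realFieldType) (K : set (R * R)) : Prop :=
  forall a b : R, exists2 t, K t & forall z, K z -> a * z.1 + b * z.2 <= a * t.1 + b * t.2.

Lemma attains_max_frame (R : realFieldType) (K : set (R * R)) (o e1 e2 : R * R) :
  0 < e1.1 * e2.2 - e1.2 * e2.1 -> attains_max K -> attains_max (in_frame o e1 e2 K).
Proof.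
move=> D0 mK a b; pose D := e1.1 * e2.2 - e1.2 * e2.1.
pose a' := a * e2.2 - b * e1.2; pose b' := b * e1.1 - a * e2.1.
have [t Kt tmax] := mK a' b'.
rewrite -(frame_point_surj o D0 t) in Kt tmax.
set u := (X in frame_point _ _ _ X) in Kt tmax; exists u => // z /tmax /=.
have E w : a' * (frame_point o e1 e2 w).1 + b' * (frame_point o e1 e2 w).2 =
    (a' * o.1 + b' * o.2) + D * (a * w.1 + b * w.2) by rewrite /a' /b' /D /=; ring.
by move: (E z) (E u) => /= -> ->; rewrite lerD2l ler_pM2l.
Qed.

Lemma extremes_exist (R : realFieldType) (K : set (R * R)) : attains_max K ->
  exists hR hT hL hB yR xT yL xB, extremes K hR hT hL hB yR xT yL xB.
Proof.
move=> mK; have [tR KR bR] := mK 1 0; have [tT KT bT] := mK 0 1.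
have [tL KL bL] := mK (-1) 0; have [tB KB bB] := mK 0 (-1).
exists (tR.1 - 1), (tT.2 - 1), (- 1 - tL.1), (- 1 - tB.2), tR.2, tT.1, tL.2, tB.1.
by split; rewrite ?(addrC 1) ?subrK ?opprB ?(addrC (-1)) ?addrK ?subrK
  -?surjective_pairing //; [move=> z /bR|move=> z /bT|move=> z /bL|move=> z /bB]; lra.
Qed.

(** Varignon's parallelogram: the midpoints of the sides are the centroid plus or minus a quarter of
    each diagonal, so the origin is the centroid and the axes are quarter diagonals. The frame has
    determinant [quad_det / 16], which turns the minimal determinant into 16. *)
Lemma normalized_min_quad (R : realFieldType) (K : set (R * R)) (A : R) v1 v2 v3 v4 :
  circumscribed K v1 v2 v3 v4 ->
  (forall w1 w2 w3 w4, circumscribed K w1 w2 w3 w4 ->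
     quad_det v1 v2 v3 v4 <= quad_det w1 w2 w3 w4) ->
  0 < det3 v1 v2 v3 -> 0 < det3 v2 v3 v4 -> 0 < det3 v3 v4 v1 -> 0 < det3 v4 v1 v2 ->
  K ((v1.1 + v2.1) / 2, (v1.2 + v2.2) / 2) -> K ((v2.1 + v3.1) / 2, (v2.2 + v3.2) / 2) ->
  K ((v3.1 + v4.1) / 2, (v3.2 + v4.2) / 2) -> K ((v4.1 + v1.1) / 2, (v4.2 + v1.2) / 2) ->
  (forall c, inner_area K c -> c <= A) ->
  normalized (in_frame ((v1.1 + v2.1 + v3.1 + v4.1) / 4, (v1.2 + v2.2 + v3.2 + v4.2) / 4)
    ((v3.1 - v1.1) / 4, (v3.2 - v1.2) / 4) ((v4.1 - v2.1) / 4, (v4.2 - v2.2) / 4) K)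
    (A / (quad_det v1 v2 v3 v4 / 16)).
Proof.
move=> cir vmin d1 d2 d3 d4 n1 n2 n3 n4 maxA.
set o := (X in in_frame X); set e1 := (X in in_frame _ X); set e2 := (X in in_frame _ _ X).
set D := quad_det _ _ _ _ / 16.
have DE : e1.1 * e2.2 - e1.2 * e2.1 = D by rewrite /D /quad_det /=; field.
have D0 : 0 < e1.1 * e2.2 - e1.2 * e2.1 by rewrite DE divr_gt0 // (quad_det_gt0 cir).
case: cir => _ _ _ _ s1 s2 s3 s4 q.
split.
- by rewrite /in_frame /frame_point /o /e1 /e2 /=; move: n3; congr (K (_, _)); field.
- by rewrite /in_frame /frame_point /o /e1 /e2 /=; move: n4; congr (K (_, _)); field.
- by rewrite /in_frame /frame_point /o /e1 /e2 /=; move: n1; congr (K (_, _)); field.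
- by rewrite /in_frame /frame_point /o /e1 /e2 /=; move: n2; congr (K (_, _)); field.
- exists (det3 v3 v4 v1, det3 v2 v3 v4) => // z /s3.
  by rewrite /left_side /det3 /=; lra.
- exists (det3 v3 v4 v1, det3 v4 v1 v2) => // z /s4.
  by rewrite /left_side /det3 /=; lra.
- exists (det3 v1 v2 v3, det3 v4 v1 v2) => // z /s1.
  by rewrite /left_side /det3 /=; lra.
- exists (det3 v1 v2 v3, det3 v2 v3 v4) => // z /s2.
  by rewrite /left_side /det3 /=; lra.
- move=> w1 w2 w3 w4 /(circumscribed_frame D0) /vmin.
  rewrite quad_det_frame DE (_ : quad_det v1 v2 v3 v4 = D * 16); last first.
    by rewrite /D; field.
  by rewrite ler_pM2l // -DE.
- move=> c /(inner_area_frame D0) /maxA; rewrite DE => cA.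
  by rewrite ler_pdivlMr -?DE // mulrC DE.
Qed.

(** * Quadrangles of minimal area *)

Lemma circumscribed_cycle (R : realFieldType) (K : set (R * R)) v1 v2 v3 v4 :
  circumscribed K v1 v2 v3 v4 -> circumscribed K v2 v3 v4 v1.
Proof.
case=> t1 t2 t3 t4 s1 s2 s3 s4 q; split=> //.
by move: q; rewrite /quad_det; congr (_ < _); ring.
Qed.

Lemma quad_det_cycle (R : realFieldType) (v1 v2 v3 v4 : R * R) :
  quad_det v2 v3 v4 v1 = quad_det v1 v2 v3 v4.
Proof. by rewrite /quad_det; ring. Qed.

(** An affine function positive at 0 and at u is positive in between, so the minimum of the
    individual choices works; [c / (1 + |b|)] is one for c + s b. *)
Lemma small_affine_gt0 (R : realFieldType) (l : seq (R * R)) :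
  all (fun p => 0 < p.1) l -> exists2 s, 0 < s & all (fun p => 0 < p.1 + s * p.2) l.
Proof.
elim: l => [|[c b] l IH] /=; first by exists 1.
case/andP=> c0 /[dup] l0 /IH [s s0 ls].
have mono (c' b' u v : R) : 0 < c' -> 0 < c' + u * b' -> 0 < v -> v <= u -> 0 < c' + v * b'.
  move=> c'0 cu v0 vu; have [b0|b0] := lerP 0 b'.
    by rewrite ltr_wpDr // mulr_ge0 // ltW.
  apply: lt_le_trans cu _; rewrite lerD2l; apply: ler_wnM2r => //; exact: ltW.
pose v := Num.min s (c / (1 + `|b|)).
have B0 : 0 < 1 + `|b| by rewrite ltr_pwDl.
have v0 : 0 < v by rewrite lt_min s0 divr_gt0.
exists v => //; apply/andP; split.
  apply: (mono _ _ (c / (1 + `|b|))) => //; last by rewrite ge_min lexx orbT.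
  rewrite (_ : c + _ = c / (1 + `|b|) * (1 + `|b| + b)); last first.
    by field; rewrite gt_eqF.
  rewrite mulr_gt0 ?divr_gt0 // -addrA ltr_pwDl //.
  by rewrite -lerBlDr sub0r -normrN ler_norm.
apply/allP => p pl; apply: (mono _ _ s) => //; first by exact: (allP l0).
  exact: (allP ls).
by rewrite ge_min lexx.
Qed.

(* Turning the side [v1 v2] slightly towards the line [l = 0] changes the
   determinant by [s * (l v1 + l v2)] to first order in [s]. *)
Lemma tilt_side (R : realFieldType) (K : set (R * R)) v1 v2 v3 v4 (al be ga : R)
    (l := fun z : R * R => al * z.1 + be * z.2 + ga) :
  circumscribed K v1 v2 v3 v4 ->
  0 < det3 v1 v2 v3 -> 0 < det3 v2 v3 v4 -> 0 < det3 v3 v4 v1 -> 0 < det3 v4 v1 v2 ->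
  (forall z, K z -> 0 <= l z) -> l v1 + l v2 < 0 ->
  exists w1 w2, circumscribed K w1 w2 v3 v4 /\
    quad_det w1 w2 v3 v4 < quad_det v1 v2 v3 v4.
Proof.
move=> cir d1 d2 d3 d4 lK l12.
pose X := (v4.1 - v1.1) * (v3.2 - v2.2) - (v4.2 - v1.2) * (v3.1 - v2.1).
set D1 := det3 v1 v2 v3 in d1; set D2 := det3 v2 v3 v4 in d2.
set D3 := det3 v3 v4 v1 in d3; set D4 := det3 v4 v1 v2 in d4.
(* A pair (c, b) stands for c + s b. In order: the denominators [E1] and [E4], the values at [v3]
   and [v4] of the function defining the new side, the turns at the new vertices with denominators
   cleared, and the decrease of [quad_det] times E1 E4 / s. *)
have [] := @small_affine_gt0 _ [:: (D1, l v3 - l v2); (D4, l v4 - l v1); (D1, l v3);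
  (D4, l v4); (D4 * D1, l v4 * D1 - l v1 * D2); (D1 * D4, l v3 * D4 - l v2 * D3);
  (- (D1 * D4 * (l v1 + l v2)), - (l v2 * D1 * (l v4 - l v1) +
     l v1 * D4 * (l v3 - l v2) + l v1 * l v2 * X))].
  rewrite /= d1 d4 !mulr_gt0 //= oppr_gt0 nmulr_llt0 ?mulr_gt0 //.
move=> s s0 /= /and5P[]; set E1 := D1 + _; set E4 := D4 + _.
move=> e1 e4 f3 f4 /and4P[g1 g2 g3 _].
(* The new side is the zero line of [f] below; [sig] and [tau] locate where it meets the lines
   [v1 v4] and [v2 v3]. *)
pose tau := - (s * l v2) / E1; pose sig := - (s * l v1) / E4.
have tE : tau * E1 = - (s * l v2) by rewrite divfK ?gt_eqF.
have sE : sig * E4 = - (s * l v1) by rewrite divfK ?gt_eqF.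
pose w1 : R * R := (v1.1 + sig * (v4.1 - v1.1), v1.2 + sig * (v4.2 - v1.2)).
pose w2 : R * R := (v2.1 + tau * (v3.1 - v2.1), v2.2 + tau * (v3.2 - v2.2)).
pose f z := det3 v1 v2 z + s * l z.
have f3' : 0 < f v3 by [].
have fw1 : f w1 = 0.
  rewrite (_ : f w1 = s * l v1 + sig * E4); first by rewrite sE subrr.
  by rewrite /f /E4 /D4 /l /w1 /det3 /=; ring.
have fw2 : f w2 = 0.
  rewrite (_ : f w2 = s * l v2 + tau * E1); first by rewrite tE subrr.
  by rewrite /f /E1 /D1 /l /w2 /det3 /=; ring.
have t1 : 0 < 1 - tau.
  rewrite -(pmulr_lgt0 _ e1) mulrBl tE mul1r opprK; move: f3; congr (_ < _).
  by rewrite /E1; ring.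
have s1 : 0 < 1 - sig.
  rewrite -(pmulr_lgt0 _ e4) mulrBl sE mul1r opprK; move: f4; congr (_ < _).
  by rewrite /E4; ring.
have turn1 : 0 < det3 w1 w2 v3.
  have -> : det3 w1 w2 v3 = (1 - tau) * ((1 - sig) * D1 + sig * D2).
    by rewrite /D1 /D2 /w1 /w2 /det3 /=; ring.
  rewrite mulr_gt0 // -(pmulr_lgt0 _ e4); move: g1; congr (_ < _).
  transitivity (E4 * D1 - sig * E4 * D1 + sig * E4 * D2); last by ring.
  by rewrite sE /E4; ring.
have turn4 : 0 < det3 v4 w1 w2.
  have -> : det3 v4 w1 w2 = (1 - sig) * ((1 - tau) * D4 + tau * D3).
    by rewrite /D4 /D3 /w1 /w2 /det3 /=; ring.
  rewrite mulr_gt0 // -(pmulr_lgt0 _ e1); move: g2; congr (_ < _).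
  transitivity (E1 * D4 - tau * E1 * D4 + tau * E1 * D3); last by ring.
  by rewrite tE /E1; ring.
case: cir => c1 c2 c3 c4 k1 k2 k3 k4 q.
have wv : quad_det w1 w2 v3 v4 < quad_det v1 v2 v3 v4.
  rewrite -subr_lt0.
  have -> : quad_det w1 w2 v3 v4 - quad_det v1 v2 v3 v4 =
      - tau * D1 - sig * D4 + sig * tau * X.
    by rewrite /quad_det /w1 /w2 /D1 /D4 /X /det3 /=; ring.
  rewrite -oppr_gt0 -(pmulr_lgt0 _ (mulr_gt0 e1 e4)).
  have -> : - (- tau * D1 - sig * D4 + sig * tau * X) * (E1 * E4) =
     (tau * E1) * E4 * D1 + (sig * E4) * E1 * D4 - (sig * E4) * (tau * E1) * X by ring.
  rewrite tE sE; have := mulr_gt0 s0 g3; congr (_ < _).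
  by rewrite /E1 /E4; ring.
have turn2 : 0 < det3 w2 v3 v4.
  rewrite (_ : det3 w2 v3 v4 = (1 - tau) * D2) ?mulr_gt0 //.
  by rewrite /D2 /w2 /det3 /=; ring.
have turn3 : 0 < det3 v3 v4 w1.
  rewrite (_ : det3 v3 v4 w1 = (1 - sig) * D3) ?mulr_gt0 //.
  by rewrite /D3 /w1 /det3 /=; ring.
exists w1, w2; split=> //; split; rewrite ?ltW //.
- move=> z Kz; rewrite /left_side /= -(pmulr_rge0 _ f3').
  (* An affine function is interpolated from its values at [w1], [w2], [v3]. As [f] vanishes at the
     first two, it is a positive multiple of [det3 w1 w2]. *)
  rewrite (_ : f v3 * det3 w1 w2 z = f z * det3 w1 w2 v3).
    rewrite mulr_ge0 ?(ltW turn1) // addr_ge0 //; first exact: k1.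
    by rewrite mulr_ge0 ?lK // ltW.
  have : f z * det3 w1 w2 v3 = f w1 * det3 z w2 v3 + f w2 * det3 w1 z v3 +
      f v3 * det3 w1 w2 z by rewrite /f /l /det3; ring.
  by rewrite fw1 fw2 !mul0r !add0r.
- move=> z /k2; rewrite /left_side /= => Kz.
  rewrite (_ : det3 w2 v3 z = (1 - tau) * det3 v2 v3 z); first by rewrite mulr_ge0 // ltW.
  by rewrite /w2 /det3 /=; ring.
- move=> z /k4; rewrite /left_side /= => Kz.
  rewrite (_ : det3 v4 w1 z = (1 - sig) * det3 v4 v1 z); first by rewrite mulr_ge0 // ltW.
  by rewrite /w1 /det3 /=; ring.
- have -> : quad_det w1 w2 v3 v4 = det3 w1 w2 v3 + det3 v3 v4 w1.
    by rewrite /quad_det /det3; ring.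
  exact: addr_gt0.
Qed.

(* A triangle containing [K] but with a vertex outside [K] can be cut parallel to
   its opposite side, leaving a smaller circumscribed quadrangle. *)
Lemma corner_cut (R : realFieldType) (K : set (R * R)) a b c :
  attains_max K -> 0 < det3 a b c ->
  K `<=` left_side a b -> K `<=` left_side b c -> K `<=` left_side c a -> ~ K a ->
  exists a1 a2, circumscribed K a1 b c a2 /\ quad_det a1 b c a2 < det3 a b c.
Proof.
move=> mK d0 kab kbc kca Ka.
have [t Kt tmax] := mK (- (c.2 - b.2)) (c.1 - b.1).
set d := det3 a b c in d0 *.
have bE z : det3 b c z = - (c.2 - b.2) * z.1 + (c.1 - b.1) * z.2 +
    ((c.2 - b.2) * b.1 - (c.1 - b.1) * b.2) by rewrite /det3; ring.
(* [t] is the point of [K] farthest from the line [b c]. At full height its other two barycentric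
   coordinates would vanish, making it equal to [a]. *)
have td : det3 b c t < d.
  have sum : det3 a b t + det3 b c t + det3 c a t = d by rewrite /d /det3; ring.
  have abt : 0 <= det3 a b t := kab _ Kt; have cat : 0 <= det3 c a t := kca _ Kt.
  rewrite lt_neqAle; apply/andP; split; last by clear -sum abt cat; lra.
  apply/eqP => E; apply: Ka; suff -> : a = t by [].
  have [abt0 cat0] : det3 a b t = 0 /\ det3 c a t = 0 by clear -sum abt cat E; split; lra.
  rewrite [a]surjective_pairing [t]surjective_pairing; congr (_, _); apply: (mulIf (lt0r_neq0 d0)).
    transitivity (a.1 * d + det3 a b t * (c.1 - a.1) + det3 c a t * (b.1 - a.1)).
      by rewrite abt0 cat0; ring.
    by rewrite /d /det3; ring.
  transitivity (a.2 * d + det3 a b t * (c.2 - a.2) + det3 c a t * (b.2 - a.2)).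
    by rewrite abt0 cat0; ring.
  by rewrite /d /det3; ring.
(* The fraction of the height cut off. The second term keeps [t] below the cut; the cap 1/2 keeps
   the remaining trapezoid from collapsing onto [b c]. *)
pose s := Num.min (1 / 2) (1 - det3 b c t / d).
have s0 : 0 < s by rewrite lt_min divr_gt0 //= subr_gt0 ltr_pdivrMr // mul1r.
have s1 : s <= 1 / 2 by rewrite ge_min lexx.
have sd : det3 b c t <= (1 - s) * d.
  by rewrite -ler_pdivrMr // lerBrDr addrC -lerBrDr ge_min lexx orbT.
have s1' : 0 < 1 - s by clear -s1; lra.
exists (a.1 + s * (b.1 - a.1), a.2 + s * (b.2 - a.2)).
exists (a.1 + s * (c.1 - a.1), a.2 + s * (c.2 - a.2)); set a1 := (_, _); set a2 := (_, _).
have qE : quad_det a1 b c a2 = d * (1 - s ^+ 2).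
  by rewrite /quad_det /a1 /a2 /d /det3 /=; ring.
have s2 : 0 < s ^+ 2 by rewrite exprn_gt0.
have s2' : s ^+ 2 < 1 by rewrite exprn_ilt1 // ?ltW //; clear -s1; lra.
split; last by rewrite qE gtr_pMr // ltrBlDr ltrDl.
split.
- rewrite (_ : det3 a1 b c = (1 - s) * d); last by rewrite /d /a1 /det3 /=; ring.
  by rewrite mulr_ge0 ?ltW.
- rewrite (_ : det3 b c a2 = (1 - s) * d); last by rewrite /d /a2 /det3 /=; ring.
  by rewrite mulr_ge0 ?ltW.
- rewrite (_ : det3 c a2 a1 = s * (1 - s) * d).
    by rewrite !mulr_ge0 ?ltW.
  by rewrite /d /a1 /a2 /det3 /=; ring.
- rewrite (_ : det3 a2 a1 b = s * (1 - s) * d).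
    by rewrite !mulr_ge0 ?ltW.
  by rewrite /d /a1 /a2 /det3 /=; ring.
- move=> z /kab; rewrite /left_side /= => Kz.
  rewrite (_ : det3 a1 b z = (1 - s) * det3 a b z); first by rewrite mulr_ge0 // ltW.
  by rewrite /a1 /det3 /=; ring.
- exact: kbc.
- move=> z /kca; rewrite /left_side /= => Kz.
  rewrite (_ : det3 c a2 z = (1 - s) * det3 c a z); first by rewrite mulr_ge0 // ltW.
  by rewrite /a2 /det3 /=; ring.
- move=> z Kz; rewrite /left_side /=.
  rewrite (_ : det3 a2 a1 z = s * ((1 - s) * d - det3 b c z)).
    apply: mulr_ge0; first exact: ltW.
    rewrite subr_ge0; apply: le_trans sd; rewrite !bE lerD2r; exact: tmax.
  by rewrite /a1 /a2 /d /det3 /=; ring.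
- by rewrite qE mulr_gt0 // subr_gt0.
Qed.

(** The quadrangle is then the triangle [v1 v3 v4]. By minimality and [corner_cut], [K] contains its
    vertices, so the triangle itself is the certificate. *)
Lemma min_quad_triangle (R : realFieldType) (K : set (R * R)) v1 v2 v3 v4 :
  attains_max K -> circumscribed K v1 v2 v3 v4 ->
  (forall w1 w2 w3 w4, circumscribed K w1 w2 w3 w4 ->
     quad_det v1 v2 v3 v4 <= quad_det w1 w2 w3 w4) ->
  det3 v1 v2 v3 = 0 -> inner_area K (quad_det v1 v2 v3 v4 / 2).
Proof.
move=> mK [t1 t2 t3 t4 k1 k2 k3 k4 q] vmin d.
have qE : quad_det v1 v2 v3 v4 = det3 v1 v3 v4.
  by rewrite -[RHS]add0r -d /quad_det /det3; ring.
have k13 : K `<=` left_side v1 v3.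
  move=> z Kz; rewrite /left_side /=.
  rewrite (_ : det3 v1 v3 z = det3 v1 v2 z + det3 v2 v3 z - det3 v1 v2 v3).
    by rewrite d subr0 addr_ge0 //; [exact: k1 | exact: k2].
  by rewrite /det3; ring.
have vertex a b c : 0 < det3 a b c -> det3 a b c = quad_det v1 v2 v3 v4 ->
    K `<=` left_side a b -> K `<=` left_side b c -> K `<=` left_side c a -> K a.
  move=> d0 dE kab kbc kca; apply: contrapT => /(corner_cut mK d0 kab kbc kca).
  by case=> a1 [a2 [/vmin]]; rewrite dE => H; rewrite ltNge H.
rewrite qE in q vertex *; apply: inner_triangle.
- exact: (vertex v1 v3 v4).
- by apply: (vertex v3 v4 v1) => //; [move: q; congr (_ < _)|]; rewrite /det3; ring.
- by apply: (vertex v4 v1 v3) => //; [move: q; congr (_ < _)|]; rewrite /det3; ring.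
Qed.

Definition separated (R : realFieldType) (K : set (R * R)) : Prop :=
  forall n, ~ K n -> exists al be ga : R,
    (forall z, K z -> 0 <= al * z.1 + be * z.2 + ga) /\ al * n.1 + be * n.2 + ga < 0.

Lemma min_quad_midpoint (R : realFieldType) (K : set (R * R)) v1 v2 v3 v4 :
  separated K -> circumscribed K v1 v2 v3 v4 ->
  0 < det3 v1 v2 v3 -> 0 < det3 v2 v3 v4 -> 0 < det3 v3 v4 v1 -> 0 < det3 v4 v1 v2 ->
  (forall w1 w2 w3 w4, circumscribed K w1 w2 w3 w4 ->
     quad_det v1 v2 v3 v4 <= quad_det w1 w2 w3 w4) ->
  K ((v1.1 + v2.1) / 2, (v1.2 + v2.2) / 2).
Proof.
move=> sK cir d1 d2 d3 d4 vmin; apply: contrapT => /sK [al [be [ga [lK ln]]]].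
have l12 : al * v1.1 + be * v1.2 + ga + (al * v2.1 + be * v2.2 + ga) < 0.
  by move: ln => /=; lra.
have [w1 [w2 [/vmin]]] := tilt_side cir d1 d2 d3 d4 lK l12.
by move=> H; rewrite ltNge H.
Qed.

Lemma min_quad_area (R : realFieldType) (K : set (R * R)) (A s eps : R) v1 v2 v3 v4 :
  attains_max K -> separated K -> circumscribed K v1 v2 v3 v4 ->
  (forall w1 w2 w3 w4, circumscribed K w1 w2 w3 w4 ->
     quad_det v1 v2 v3 v4 <= quad_det w1 w2 w3 w4) ->
  (forall c, inner_area K c -> c <= A) ->
  0 <= s -> s ^+ 2 = 2 -> 0 <= eps -> eps <= 1 / 1000 / 1000 ->
  s / 2 * (1 + eps) * (quad_det v1 v2 v3 v4 / 2) < A.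
Proof.
move=> mK sK cir vmin maxA s0 s2 eps0 eps1; rewrite ltNge; apply/negP => As.
have q0 := quad_det_gt0 cir.
have sE : s / 2 * (1 + eps) < 1.
  have s1 : s <= 3 / 2 by rewrite -(ler_pXn2r (n := 2)) ?nnegrE // ?s2 //; lra.
  have : s * eps <= 3 / 2 * (1 / 1000 / 1000) by apply: ler_pM.
  by clear -s1; lra.
(* If a turn vanished, [K] would have at least the area of the quadrangle, against [sE]. Stating it
   for any relabelling yields all four strict turns. *)
have turn u1 u2 u3 u4 : circumscribed K u1 u2 u3 u4 ->
    quad_det u1 u2 u3 u4 = quad_det v1 v2 v3 v4 -> 0 < det3 u1 u2 u3.
  move=> ucir uE; rewrite lt_neqAle (turn123 ucir) andbT; apply/eqP => /esym d.
  have umin w1 w2 w3 w4 : circumscribed K w1 w2 w3 w4 ->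
      quad_det u1 u2 u3 u4 <= quad_det w1 w2 w3 w4 by rewrite uE; exact: vmin.
  have /maxA := min_quad_triangle mK ucir umin d; rewrite uE => qA.
  have h : 0 < quad_det v1 v2 v3 v4 / 2 by rewrite divr_gt0.
  move: sE; rewrite -(ltr_pM2r h) mul1r => /lt_le_trans /(_ (le_trans qA As)).
  by rewrite ltxx.
have c2 := circumscribed_cycle cir; have q2 := quad_det_cycle v1 v2 v3 v4.
have c3 := circumscribed_cycle c2; have q3 := quad_det_cycle v2 v3 v4 v1.
have c4 := circumscribed_cycle c3; have q4 := quad_det_cycle v3 v4 v1 v2.
rewrite q2 in q3; rewrite q3 in q4.
have d1 := turn _ _ _ _ cir erefl; have d2 := turn _ _ _ _ c2 q2.
have d3 := turn _ _ _ _ c3 q3; have d4 := turn _ _ _ _ c4 q4.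
have n1 := min_quad_midpoint sK cir d1 d2 d3 d4 vmin.
have n2 := min_quad_midpoint sK c2 d2 d3 d4 d1 (eq_ind_r (fun q => forall w1 w2 w3 w4,
  circumscribed K w1 w2 w3 w4 -> q <= quad_det w1 w2 w3 w4) vmin q2).
have n3 := min_quad_midpoint sK c3 d3 d4 d1 d2 (eq_ind_r (fun q => forall w1 w2 w3 w4,
  circumscribed K w1 w2 w3 w4 -> q <= quad_det w1 w2 w3 w4) vmin q3).
have n4 := min_quad_midpoint sK c4 d4 d1 d2 d3 (eq_ind_r (fun q => forall w1 w2 w3 w4,
  circumscribed K w1 w2 w3 w4 -> q <= quad_det w1 w2 w3 w4) vmin q4).
have nK := normalized_min_quad cir vmin d1 d2 d3 d4 n1 n2 n3 n4 maxA.
have D0 : 0 < (v3.1 - v1.1) / 4 * ((v4.2 - v2.2) / 4) -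
    (v3.2 - v1.2) / 4 * ((v4.1 - v2.1) / 4).
  rewrite (_ : _ - _ = quad_det v1 v2 v3 v4 / 16) ?divr_gt0 //.
  by rewrite /quad_det; field.
have [hR [hT [hL [hB [yR [xT [yL [xB eK]]]]]]]] :=
  extremes_exist (attains_max_frame ((v1.1 + v2.1 + v3.1 + v4.1) / 4,
    (v1.2 + v2.2 + v3.2 + v4.2) / 4) (e1 := ((v3.1 - v1.1) / 4, (v3.2 - v1.2) / 4))
    (e2 := ((v4.1 - v2.1) / 4, (v4.2 - v2.2) / 4)) D0 mK).
have := normalized_area_gt nK eK s0 s2 eps0 eps1; apply/negP; rewrite -leNgt.
rewrite ler_pdivrMr ?divr_gt0 //; apply: le_trans As _.
by rewrite le_eqVlt; apply/orP; left; apply/eqP; field.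
Qed.

Lemma circumscribed_barycentric (R : realFieldType) (K : set (R * R)) v1 v2 v3 v4 z :
  circumscribed K v1 v2 v3 v4 -> K z ->
  exists a b c d : R, [/\ 0 <= a, 0 <= b, 0 <= c & 0 <= d] /\ [/\ a + b + c + d = 1,
    z.1 = a * v1.1 + b * v2.1 + c * v3.1 + d * v4.1 &
    z.2 = a * v1.2 + b * v2.2 + c * v3.2 + d * v4.2].
Proof.
case=> t1 t2 t3 t4 s1 s2 s3 s4 q Kz.
have [z1 z2] : 0 <= det3 v1 v2 z /\ 0 <= det3 v2 v3 z by split; [exact: s1|exact: s2].
have [z3 z4] : 0 <= det3 v3 v4 z /\ 0 <= det3 v4 v1 z by split; [exact: s3|exact: s4].
have t13 : det3 v3 v4 v1 = det3 v1 v3 v4 by rewrite /det3; ring.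
have q13 : quad_det v1 v2 v3 v4 = det3 v1 v2 v3 + det3 v1 v3 v4.
  by rewrite /quad_det /det3; ring.
have E1 : det3 v1 v2 z + det3 v2 v3 z - det3 v1 v3 z = det3 v1 v2 v3.
  by rewrite /det3; ring.
have E2 : det3 v1 v3 z + det3 v3 v4 z + det3 v4 v1 z = det3 v1 v3 v4.
  by rewrite /det3; ring.
rewrite t13 in t3.
have dn (x : R) : 0 < x -> x != 0 by move=> x0; rewrite gt_eqF.
(* The diagonal [v1 v3] may cut off a flat half. A point on the side of a flat half is on the
   diagonal itself, so the other half contains it. *)
have half : 0 < det3 v1 v2 v3 /\ det3 v1 v3 z <= 0 \/
    0 < det3 v1 v3 v4 /\ 0 <= det3 v1 v3 z.
  have [z13|z13] := ltrP (det3 v1 v3 z) 0.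
    by left; split; [clear -E1 z1 z2 z13; lra | exact: ltW].
  have [d0|d0] := ltrP 0 (det3 v1 v3 v4); first by right.
  by left; clear -q q13 E1 E2 z1 z2 z3 z4 z13 d0; split; lra.
case: half => -[/[dup] /dn d0' d0 z13].
- exists (det3 v2 v3 z / det3 v1 v2 v3), (- det3 v1 v3 z / det3 v1 v2 v3).
  exists (det3 v1 v2 z / det3 v1 v2 v3), 0; split.
    by split=> //; apply: divr_ge0; rewrite ?oppr_ge0 // ltW.
  split; rewrite -?mulrDl ?mul0r ?addr0; apply: (mulIf d0').
  + by rewrite divfK // mul1r -E1; ring.
  + by rewrite !(mulrAC _ _^-1) -!mulrDl divfK // /det3; ring.
  + by rewrite !(mulrAC _ _^-1) -!mulrDl divfK // /det3; ring.
- exists (det3 v3 v4 z / det3 v1 v3 v4), 0.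
  exists (det3 v4 v1 z / det3 v1 v3 v4), (det3 v1 v3 z / det3 v1 v3 v4); split.
    by split=> //; apply: divr_ge0 => //; exact: ltW.
  split; rewrite ?mul0r ?addr0 -?mulrDl; apply: (mulIf d0').
  + by rewrite divfK // mul1r -E2; ring.
  + by rewrite !(mulrAC _ _^-1) -!mulrDl divfK // /det3; ring.
  + by rewrite !(mulrAC _ _^-1) -!mulrDl divfK // /det3; ring.
Qed.

Lemma weighted_bound (R : realFieldType) (a b c d x1 x2 x3 x4 x P : R) :
  0 <= a -> 0 <= b -> 0 <= c -> 0 <= d -> a + b + c + d = 1 ->
  x = a * x1 + b * x2 + c * x3 + d * x4 ->
  `|x2 - x1| <= P -> `|x3 - x1| <= P -> `|x4 - x1| <= P -> `|x1 - x| <= P.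
Proof.
move=> a0 b0 c0 d0 abcd -> h2 h3 h4.
have P0 : 0 <= P := le_trans (normr_ge0 _) h2.
have -> : x1 - (a * x1 + b * x2 + c * x3 + d * x4) =
    - (b * (x2 - x1) + c * (x3 - x1) + d * (x4 - x1)).
  by rewrite -{1}[x1]mul1r -abcd; ring.
rewrite normrN; apply: (@le_trans _ _ (b * P + c * P + d * P)).
  apply: le_trans (ler_normD _ _) _; apply: lerD; last first.
    by rewrite normrM (ger0_norm d0) ler_wpM2l.
  apply: le_trans (ler_normD _ _) _; apply: lerD.
    by rewrite normrM (ger0_norm b0) ler_wpM2l.
  by rewrite normrM (ger0_norm c0) ler_wpM2l.
rewrite -!mulrDl -[leRHS]mul1r -abcd ler_wpM2r //.
by rewrite -!addrA lerDr.
Qed.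

(* The distance from the centre of an inscribed square of half-side [r] to each
   side line is at least [r], so [r] times the perimeter is at most [quad_det]. *)
Lemma circumscribed_bounded (R : realFieldType) (K : set (R * R)) v1 v2 v3 v4 m (r : R) :
  circumscribed K v1 v2 v3 v4 -> 0 < r ->
  (forall u v : R, `|u| <= r -> `|v| <= r -> K (m.1 + u, m.2 + v)) ->
  `|v1.1 - m.1| <= quad_det v1 v2 v3 v4 / r /\ `|v1.2 - m.2| <= quad_det v1 v2 v3 v4 / r.
Proof.
move=> cir r0 Ko; have r00 := ltW r0.
have Koo : K m.
  rewrite [m]surjective_pairing -[m.1]addr0 -[m.2]addr0.
  by apply: Ko; rewrite normr0.
(* The determinant is affine in its last point; at the corner of the square nearest the line it is
   its value at [m] minus [r] times the l1 length of the edge. *)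
have edge a b : K `<=` left_side a b -> r * `|b.1 - a.1| + r * `|b.2 - a.2| <= det3 a b m.
  move=> Kab.
  have K1 : left_side a b (m.1 + r, m.2 + r) by apply/Kab/Ko; rewrite ger0_norm.
  have K2 : left_side a b (m.1 + r, m.2 - r).
    by apply/Kab/Ko; rewrite ?normrN ger0_norm.
  have K3 : left_side a b (m.1 - r, m.2 + r).
    by apply/Kab/Ko; rewrite ?normrN ger0_norm.
  have K4 : left_side a b (m.1 - r, m.2 - r) by apply/Kab/Ko; rewrite ?normrN ger0_norm.
  move: K1 K2 K3 K4; rewrite /left_side /det3 /=; clear.
  by have [h1|h1] := ger0P (b.1 - a.1); have [h2|h2] := ger0P (b.2 - a.2); lra.
(* [m] is a convex combination of the vertices, so it is no farther from [v1], in each coordinate,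
   than the farthest vertex, and that is at most the perimeter. *)
have [a [b [c [d [[a0 b0 c0 d0] [abcd o1 o2]]]]]] := circumscribed_barycentric cir Koo.
have e1 := edge _ _ (side12 cir); have e2 := edge _ _ (side23 cir).
have e3 := edge _ _ (side34 cir); have e4 := edge _ _ (side41 cir).
have qE : quad_det v1 v2 v3 v4 =
    det3 v1 v2 m + det3 v2 v3 m + det3 v3 v4 m + det3 v4 v1 m.
  by rewrite /quad_det /det3; ring.
move: e1 e2 e3 e4 qE; set q := quad_det _ _ _ _.
set D1 := det3 v1 _ _; set D2 := det3 v2 _ _; set D3 := det3 v3 _ _; set D4 := det3 v4 _ _.
clearbody q D1 D2 D3 D4 => e1 e2 e3 e4 qE.
have n0 (x : R) : 0 <= r * `|x| by rewrite mulr_ge0.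
have tri (x y z : R) : r * `|z - x| <= r * `|z - y| + r * `|y - x|.
  rewrite -mulrDr ler_wpM2l //.
  by rewrite (_ : z - x = (z - y) + (y - x)) ?ler_normD //; ring.
split.
- apply: (weighted_bound a0 b0 c0 d0 abcd o1); rewrite ler_pdivlMr // mulrC.
  + have := (n0 (v2.2 - v1.2), n0 (v3.1 - v2.1), n0 (v3.2 - v2.2), n0 (v4.1 - v3.1),
      n0 (v4.2 - v3.2), n0 (v1.1 - v4.1), n0 (v1.2 - v4.2)) => -[[[[[[]]]]]].
    by clear -e1 e2 e3 e4 qE; lra.
  + have := (n0 (v2.2 - v1.2), n0 (v3.2 - v2.2), n0 (v4.1 - v3.1),
      n0 (v4.2 - v3.2), n0 (v1.1 - v4.1), n0 (v1.2 - v4.2)) => -[[[[[]]]]].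
    by have := tri v1.1 v2.1 v3.1; clear -e1 e2 e3 e4 qE; lra.
  + have := (n0 (v2.1 - v1.1), n0 (v2.2 - v1.2), n0 (v3.1 - v2.1), n0 (v3.2 - v2.2),
      n0 (v4.1 - v3.1), n0 (v4.2 - v3.2), n0 (v1.2 - v4.2)) => -[[[[[[]]]]]].
    by rewrite [`|v4.1 - v1.1|]distrC; clear -e1 e2 e3 e4 qE; lra.
- apply: (weighted_bound a0 b0 c0 d0 abcd o2); rewrite ler_pdivlMr // mulrC.
  + have := (n0 (v2.1 - v1.1), n0 (v3.1 - v2.1), n0 (v3.2 - v2.2), n0 (v4.1 - v3.1),
      n0 (v4.2 - v3.2), n0 (v1.1 - v4.1), n0 (v1.2 - v4.2)) => -[[[[[[]]]]]].
    by clear -e1 e2 e3 e4 qE; lra.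
  + have := (n0 (v2.1 - v1.1), n0 (v3.1 - v2.1), n0 (v4.1 - v3.1),
      n0 (v4.2 - v3.2), n0 (v1.1 - v4.1), n0 (v1.2 - v4.2)) => -[[[[[]]]]].
    by have := tri v1.2 v2.2 v3.2; clear -e1 e2 e3 e4 qE; lra.
  + have := (n0 (v2.1 - v1.1), n0 (v2.2 - v1.2), n0 (v3.1 - v2.1), n0 (v3.2 - v2.2),
      n0 (v4.1 - v3.1), n0 (v4.2 - v3.2), n0 (v1.1 - v4.1)) => -[[[[[[]]]]]].
    by rewrite [`|v4.2 - v1.2|]distrC; clear -e1 e2 e3 e4 qE; lra.
Qed.

(** * Existence of a minimal quadrangle *)

Section Topology.
Variable R : realType.
Implicit Types K : set (plane R).

Lemma convex_set_segment K x y (t : R) : convex_set K -> K x -> K y -> 0 <= t <= 1 ->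
  K (t * x.1 + (1 - t) * y.1, t * x.2 + (1 - t) * y.2).
Proof.
move=> cK Kx Ky /andP[t0 t1].
by have := @cK x y (Itv01 t0 t1) (mem_set Kx) (mem_set Ky); rewrite inE.
Qed.

Lemma interior_square K : K° !=set0 -> exists o : R * R, exists2 r, 0 < r &
  forall u v : R, `|u| <= r -> `|v| <= r -> K (o.1 + u, o.2 + v).
Proof.
case=> o /nbhs_ballP [e /= e0 oK]; exists o, (e / 2); first by rewrite divr_gt0.
by move=> u v ur vr; apply: oK; split; rewrite /ball /= opprD addrA subrr sub0r normrN;
  [apply: le_lt_trans ur _|apply: le_lt_trans vr _];
  rewrite ltr_pdivrMr // ltr_pMr // ltr1n.
Qed.

Lemma continuous_comp_fst (T U V : topologicalType) (f : T -> U * V) :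
  continuous f -> continuous (fun x => (f x).1).
Proof. by move=> cf x; apply: (cvg_comp _ _ (cf x)); exact: cvg_fst. Qed.

Lemma continuous_comp_snd (T U V : topologicalType) (f : T -> U * V) :
  continuous f -> continuous (fun x => (f x).2).
Proof. by move=> cf x; apply: (cvg_comp _ _ (cf x)); exact: cvg_snd. Qed.

Lemma continuous_sub (T : topologicalType) (f g : T -> R) :
  continuous f -> continuous g -> continuous (fun x => f x - g x).
Proof. by move=> cf cg x; apply: cvgB; [exact: cf|exact: cg]. Qed.

Lemma continuous_mul (T : topologicalType) (f g : T -> R) :
  continuous f -> continuous g -> continuous (fun x => f x * g x).
Proof. by move=> cf cg x; apply: cvgM; [exact: cf|exact: cg]. Qed.

Lemma continuous_det3 (T : topologicalType) (a b c : T -> plane R) :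
  continuous a -> continuous b -> continuous c ->
  continuous (fun x => det3 (a x) (b x) (c x) : R).
Proof.
move=> ca cb cc.
have [a1 a2] := conj (continuous_comp_fst ca) (continuous_comp_snd ca).
have [b1 b2] := conj (continuous_comp_fst cb) (continuous_comp_snd cb).
have [c1 c2] := conj (continuous_comp_fst cc) (continuous_comp_snd cc).
by do ![apply: continuous_sub|apply: continuous_mul].
Qed.

Lemma continuous_quad_det (T : topologicalType) (a b c d : T -> plane R) :
  continuous a -> continuous b -> continuous c -> continuous d ->
  continuous (fun x => quad_det (a x) (b x) (c x) (d x) : R).
Proof.
move=> ca cb cc cd.
have [a1 a2] := conj (continuous_comp_fst ca) (continuous_comp_snd ca).
have [b1 b2] := conj (continuous_comp_fst cb) (continuous_comp_snd cb).
have [c1 c2] := conj (continuous_comp_fst cc) (continuous_comp_snd cc).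
have [d1 d2] := conj (continuous_comp_fst cd) (continuous_comp_snd cd).
by do ![apply: continuous_sub|apply: continuous_mul].
Qed.

Lemma closed_nneg (T : topologicalType) (f : T -> R) :
  continuous f -> closed [set x | 0 <= f x].
Proof.
by move=> cf; apply: (@closed_comp _ _ f [set y | 0 <= y]) => //; exact: closed_ge.
Qed.

Lemma closed_left_side (a b : plane R) : closed (left_side a b : set (plane R)).
Proof.
apply: closed_nneg; apply: continuous_det3; try exact: cst_continuous.
by move=> x; exact: cvg_id.
Qed.

Lemma compact_attains_max K : compact K -> K !=set0 -> attains_max (K : set (R * R)).
Proof.
move=> cK K0 a b.
have [|t Kt tmax] := @compact_EVT_max _ _ (fun z : plane R => a * z.1 + b * z.2) K K0 cK.
  apply: continuous_subspaceT => x; apply: cvgD; apply: cvgM;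
    by [exact: cvg_cst|exact: cvg_fst|exact: cvg_snd].
by exists t; [exact: set_mem|move=> z Kz; apply: tmax; exact: mem_set].
Qed.

Lemma compact_convex_separated K : compact K -> K !=set0 -> convex_set K ->
  separated (K : set (R * R)).
Proof.
move=> cK K0 vK n nK.
pose f (z : plane R) : R := (z.1 - n.1) ^+ 2 + (z.2 - n.2) ^+ 2.
have [|t /set_mem Kt tmin] := @compact_EVT_min _ _ f K K0 cK.
  apply: continuous_subspaceT => x; apply: cvgD; apply: cvgM; apply: cvgB;
    by [exact: cvg_cst|exact: cvg_fst|exact: cvg_snd].
pose d : R * R := (t.1 - n.1, t.2 - n.2).
exists d.1, d.2, (- (d.1 * t.1 + d.2 * t.2)); split.
- move=> z Kz; pose p := d.1 * (z.1 - t.1) + d.2 * (z.2 - t.2).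
  rewrite (_ : _ - _ = p); last by rewrite /p; ring.
  rewrite leNgt; apply/negP => p0.
  pose q := (z.1 - t.1) ^+ 2 + (z.2 - t.2) ^+ 2.
  have q0 : 0 <= q by rewrite addr_ge0 ?sqr_ge0.
  have fE s : f (s * z.1 + (1 - s) * t.1, s * z.2 + (1 - s) * t.2) =
      f t + s * (2 * p + s * q) by rewrite /f /p /q /d /=; ring.
  (* With this step s q <= - p, hence 2 p + s q <= p < 0 and the distance to [n] decreases. The
     denominator 1 + q cannot vanish. *)
  pose s := Num.min 1 (- p / (1 + q)).
  have q1 : 0 < 1 + q by rewrite ltr_pwDl.
  have s0 : 0 < s by rewrite lt_min ltr01 divr_gt0 // oppr_gt0.
  have s1 : s <= 1 by rewrite ge_min lexx.
  have sq : s * (1 + q) <= - p by rewrite -ler_pdivlMr // ge_min lexx orbT.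
  have := tmin _ (mem_set (convex_set_segment vK Kz Kt (introT andP (conj (ltW s0) s1)))).
  rewrite fE lerDl pmulr_rge0 //; lra.
- have : 0 < f t.
    rewrite /f lt_neqAle addr_ge0 ?sqr_ge0 // andbT.
    apply/eqP => /esym/eqP; rewrite paddr_eq0 ?sqr_ge0 // !sqrf_eq0 !subr_eq0.
    case/andP => /eqP t1 /eqP t2; apply: nK.
    by move: Kt; rewrite [t]surjective_pairing t1 t2 -surjective_pairing.
  by rewrite /f /d /=; lra.
Qed.

End Topology.

Section MinQuad.
Variable R : realType.
Implicit Types K : set (plane R).

Lemma circumscribed_exists K : compact K ->
  exists v1 v2 v3 v4, circumscribed (K : set (R * R)) v1 v2 v3 v4.
Proof.
case/compact_bounded=> M [_ KM].
pose B := `|M| + 1; have B0 : 0 < B by rewrite ltr_pwDr.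
have KB z : K z -> `|z.1| <= B /\ `|z.2| <= B.
  have MB : M < B by rewrite (le_lt_trans (ler_norm M)) // ltrDl.
  by move/(KM _ MB); rewrite /= prod_normE ge_max => /andP[].
have {}KB z : K z -> [/\ - B <= z.1, z.1 <= B, - B <= z.2 & z.2 <= B].
  by move/KB; rewrite !ler_norml => -[/andP[? ?] /andP[? ?]].
have BB := mulr_gt0 B0 B0.
exists (- B, - B), (B, - B), (B, B), (- B, B).
split; rewrite /det3 /quad_det /=; try by clear -BB; lra.
- move=> z /KB[_ _ z3 _]; rewrite /left_side /det3 /=.
  have : 0 <= B * (z.2 + B) by apply: mulr_ge0; [exact: ltW | lra].
  by clear; lra.
- move=> z /KB[_ z2 _ _]; rewrite /left_side /det3 /=.
  have : 0 <= B * (B - z.1) by apply: mulr_ge0; [exact: ltW | lra].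
  by clear; lra.
- move=> z /KB[_ _ _ z4]; rewrite /left_side /det3 /=.
  have : 0 <= B * (B - z.2) by apply: mulr_ge0; [exact: ltW | lra].
  by clear; lra.
- move=> z /KB[z1 _ _ _]; rewrite /left_side /det3 /=.
  have : 0 <= B * (z.1 + B) by apply: mulr_ge0; [exact: ltW | lra].
  by clear; lra.
Qed.

(** Competitors no worse than a fixed quadrangle have their vertices in a fixed square by
    [circumscribed_bounded], and the bound [c] stands in for the strict positivity, so the minimum
    is over a compact set. *)
Lemma min_quad_exists K (c : R) : compact K -> K° !=set0 -> 0 < c ->
  (forall v1 v2 v3 v4, circumscribed (K : set (R * R)) v1 v2 v3 v4 ->
    c <= quad_det v1 v2 v3 v4) ->
  exists v1 v2 v3 v4, circumscribed (K : set (R * R)) v1 v2 v3 v4 /\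
    forall w1 w2 w3 w4, circumscribed (K : set (R * R)) w1 w2 w3 w4 ->
      quad_det v1 v2 v3 v4 <= quad_det w1 w2 w3 w4.
Proof.
move=> cK /interior_square [p [r r0 Kp]] c0 qc.
have [u1 [u2 [u3 [u4 ucir]]]] := circumscribed_exists cK.
set Q := quad_det u1 u2 u3 u4; pose B := Q / r.
pose Sq : set (plane R) := `[p.1 - B, p.1 + B] `*` `[p.2 - B, p.2 + B].
have cSq : compact Sq by apply: compact_setX; exact: segment_compact.
have inSq w1 w2 w3 w4 : circumscribed (K : set (R * R)) w1 w2 w3 w4 ->
    quad_det w1 w2 w3 w4 <= Q -> Sq w1.
  move=> wcir wQ; have [h1 h2] := circumscribed_bounded wcir r0 Kp.
  have h : quad_det w1 w2 w3 w4 / r <= B by rewrite ler_pM2r ?invr_gt0.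
  split => /=; rewrite in_itv /=.
    by move: (le_trans h1 h); rewrite ler_norml => /andP[? ?]; apply/andP; split; lra.
  by move: (le_trans h2 h); rewrite ler_norml => /andP[? ?]; apply/andP; split; lra.
pose C : set ((plane R * plane R) * (plane R * plane R)) :=
  [set v | circumscribed (K : set (R * R)) v.1.1 v.1.2 v.2.1 v.2.2] `&`
  ((Sq `*` Sq) `*` (Sq `*` Sq)).
have p1 : continuous (fun v : (plane R * plane R) * (plane R * plane R) => v.1.1).
  by do 2!apply: continuous_comp_fst; move=> x; exact: cvg_id.
have p2 : continuous (fun v : (plane R * plane R) * (plane R * plane R) => v.1.2).
  by apply: continuous_comp_snd; apply: continuous_comp_fst; move=> x; exact: cvg_id.
have p3 : continuous (fun v : (plane R * plane R) * (plane R * plane R) => v.2.1).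
  by apply: continuous_comp_fst; apply: continuous_comp_snd; move=> x; exact: cvg_id.
have p4 : continuous (fun v : (plane R * plane R) * (plane R * plane R) => v.2.2).
  by do 2!apply: continuous_comp_snd; move=> x; exact: cvg_id.
have cC : compact C.
  rewrite /C setIC; apply: compact_closedI.
    exact: (compact_setX (compact_setX cSq cSq) (compact_setX cSq cSq)).
  have side a b : continuous a -> continuous b -> closed [set v :
      (plane R * plane R) * (plane R * plane R) | K `<=` left_side (a v) (b v)].
    move=> ca cb; rewrite (_ : [set v | _] =
      \bigcap_(z in K) [set v | 0 <= det3 (a v) (b v) z]).
      apply: closed_bigI => z _; apply: closed_nneg; apply: continuous_det3 => //.
      exact: cst_continuous.
    by apply/seteqP; split=> v; [move=> H z /H|move=> H z Kz; exact: H].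
  rewrite (_ : [set v | _] =
    [set v | 0 <= det3 v.1.1 v.1.2 v.2.1] `&` [set v | 0 <= det3 v.1.2 v.2.1 v.2.2] `&`
    [set v | 0 <= det3 v.2.1 v.2.2 v.1.1] `&` [set v | 0 <= det3 v.2.2 v.1.1 v.1.2] `&`
    [set v | K `<=` left_side v.1.1 v.1.2] `&` [set v | K `<=` left_side v.1.2 v.2.1] `&`
    [set v | K `<=` left_side v.2.1 v.2.2] `&` [set v | K `<=` left_side v.2.2 v.1.1] `&`
    [set v | 0 <= quad_det v.1.1 v.1.2 v.2.1 v.2.2 - c]).
    apply: closedI; last first.
      apply: closed_nneg; apply: continuous_sub; last exact: cst_continuous.
      exact: continuous_quad_det.
    do 4!(apply: closedI; last exact: side).
    by do 3?apply: closedI; apply: closed_nneg; exact: continuous_det3.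
  apply/seteqP; split => v /=.
    move=> vcir; have := qc _ _ _ _ vcir; rewrite -subr_ge0.
    by case: vcir => *; do !split.
  case=> [[[[[[[[? ?] ?] ?] ?] ?] ?] ?]]; rewrite subr_ge0 => qcv; split=> //.
  exact: lt_le_trans qcv.
have inC w1 w2 w3 w4 : circumscribed (K : set (R * R)) w1 w2 w3 w4 ->
    quad_det w1 w2 w3 w4 <= Q -> C ((w1, w2), (w3, w4)).
  move=> wcir wQ; split => //=.
  have c2 := circumscribed_cycle wcir; have c3 := circumscribed_cycle c2.
  have c4 := circumscribed_cycle c3.
  have S1 := inSq _ _ _ _ wcir wQ.
  have S2 : Sq w2 by apply: inSq c2 _; rewrite quad_det_cycle.
  have S3 : Sq w3 by apply: inSq c3 _; rewrite 2!quad_det_cycle.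
  have S4 : Sq w4 by apply: inSq c4 _; rewrite 3!quad_det_cycle.
  by split; split.
have C0 : C !=set0 by exists ((u1, u2), (u3, u4)); apply: inC.
have [|v /set_mem[/= vcir _] vmin] := @compact_EVT_min _ _
    (fun v => quad_det v.1.1 v.1.2 v.2.1 v.2.2) C C0 cC.
  by apply: continuous_subspaceT; apply: continuous_quad_det.
exists v.1.1, v.1.2, v.2.1, v.2.2; split=> // w1 w2 w3 w4 wcir.
have [wQ|/ltW wQ] := lerP (quad_det w1 w2 w3 w4) Q.
  by have := vmin _ (mem_set (inC _ _ _ _ wcir wQ)).
by apply: le_trans wQ; exact: vmin _ (mem_set (inC _ _ _ _ ucir (lexx _))).
Qed.

End MinQuad.

(** * Areas of polygons *)

Section Measure.
Variable R : realType.
Implicit Types A B K : set (plane R).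

Notation mplane := (measurableTypeR R * measurableTypeR R)%type.
Notation mset A := (measurable (A : set mplane)).

(** The product sigma-algebra contains rectangles, and an open set is the countable union of the
    rational squares inside it. *)
Lemma open_measurable_plane A : open A -> mset A.
Proof.
move=> oA.
pose F (i : rat * rat * nat) : set (plane R) :=
  ball (ratr i.1.1 : R) i.2.+1%:R^-1 `*` ball (ratr i.1.2 : R) i.2.+1%:R^-1.
pose G i : set (plane R) := if `[< F i `<=` A >] then F i else set0.
have -> : A = \bigcup_i G i.
  apply/seteqP; split => [x Ax|x [i _]]; last first.
    by rewrite /G; case: asboolP => // FA; exact: FA.
  have /nbhs_ballP[e /= e0 eA] : nbhs x A by rewrite nbhsE; exists A.
  have e20 : 0 < e / 2 by rewrite divr_gt0.
  have [n ne] : exists n, n.+1%:R^-1 < e / 2.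
    exists (Num.truncn ((e / 2)^-1)); rewrite invf_plt ?posrE //.
    exact: truncnS_gt.
  have n0 : 0 < n.+1%:R^-1 :> R by rewrite invr_gt0.
  have rat_near (y : R) : exists q : rat, ball (ratr q : R) n.+1%:R^-1 y.
    have /rat_in_itvoo[q] : y - n.+1%:R^-1 < y + n.+1%:R^-1 by rewrite ltrD2l gtrN.
    rewrite in_itv /= => /andP[q1 q2]; exists q.
    move: (n.+1%:R^-1 : R) q1 q2 => d q1 q2.
    by rewrite /ball /= ltr_norml; apply/andP; split; lra.
  have [[q1 h1] [q2 h2]] := (rat_near x.1, rat_near x.2).
  exists (q1, q2, n) => //; rewrite /G; case: asboolP => [_|[]]; first by split.
  have close (q y w : R) : `|q - y| < n.+1%:R^-1 -> `|q - w| < n.+1%:R^-1 -> `|y - w| < e.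
    move=> h h'; rewrite (_ : y - w = (q - w) - (q - y)); last by ring.
    apply: le_lt_trans (ler_normB _ _) _; rewrite [e]splitr.
    by apply: ltrD; [exact: lt_trans h' ne|exact: lt_trans h ne].
  by move=> z [/= z1 z2]; apply: eA; split; [exact: close h1 z1|exact: close h2 z2].
apply: countable_bigcupT_measurable => // i; rewrite /G; case: ifP => // _.
by apply: measurableX; exact: measurable_realfun.measurable_ball.
Qed.

Lemma closed_measurable_plane A : closed A -> mset A.
Proof.
by rewrite -openC => /open_measurable_plane /measurableC; rewrite setCK.
Qed.

Lemma area_vertical_line A (m : R) : (forall z, A z -> z.1 = m) -> area A = 0%E.
Proof.
move=> Am; rewrite /area /product_measure1.
rewrite (_ : (fun x => _) = (fun x => if x \in [set m] then
    (lebesgue_measure \o xsection A) x else 0%E)); last first.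
  apply/funext => x; case: ifPn => // xm /=.
  rewrite (_ : xsection A x = set0) ?measure0 //.
  apply/seteqP; split=> y //; rewrite /xsection /= inE => /Am /= xE.
  by case/negP: xm; rewrite xE; exact: mem_set.
by rewrite -/(patch _ _ _) -integral_mkcond integral_set1.
Qed.

Lemma area_line0 (a b : R * R) : a != b ->
  area ([set z | det3 a b z = 0] : set (plane R)) = 0%E.
Proof.
move=> ab; have [E|ab1] := eqVneq a.1 b.1.
  apply: (@area_vertical_line _ a.1) => z /=.
  rewrite /det3 E subrr mul0r sub0r => /eqP; rewrite oppr_eq0 mulf_eq0 !subr_eq0.
  case/orP => /eqP // E2; move: ab.
  by rewrite (surjective_pairing a) (surjective_pairing b) E E2 eqxx.
rewrite /area /product_measure1 integral0_eq // => x _ /=.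
pose y := a.2 + (b.2 - a.2) * (x - a.1) / (b.1 - a.1).
rewrite (_ : xsection _ _ = [set y]) ?lebesgue_measure_set1 //.
have ba : b.1 - a.1 != 0 by rewrite subr_eq0 eq_sym.
apply/seteqP; split=> z; rewrite /xsection /= inE /det3 /=.
  move=> zE; apply: (mulfI ba); rewrite /y mulrDr.
  rewrite [(b.1 - a.1) * (_ / _)]mulrC divfK //; lra.
by move=> ->; rewrite /y addrAC subrr add0r mulrC divfK // subrr.
Qed.

Lemma area_cut K (a b : R * R) : closed K -> a != b ->
  area K = (area (K `&` left_side a b) + area (K `&` left_side b a))%E.
Proof.
move=> cK ab.
have mK := closed_measurable_plane cK.
have mL u v : mset (K `&` left_side u v).
  by apply: closed_measurable_plane; apply: closedI => //; exact: closed_left_side.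
have EK : K = (K `&` left_side a b) `|` (K `&` left_side b a `\` left_side a b).
  apply/seteqP; split=> [z Kz|z [[]|[[]]] //].
  have [zab|zab] := lerP 0 (det3 a b z); first by left.
  right; split; first split=> //.
    rewrite /left_side /=; move: zab; rewrite /det3; lra.
  by rewrite /left_side /= leNgt zab.
have mD : mset (K `&` left_side b a `\` left_side a b).
  by apply: measurableD => //; apply: closed_measurable_plane; exact: closed_left_side.
(* The two closed half-planes share their boundary line, which is a null set. *)
have -> : area (K `&` left_side b a) = area (K `&` left_side b a `\` left_side a b).
  rewrite {1}(_ : K `&` left_side b a = (K `&` left_side b a `\` left_side a b) `|`
     (K `&` left_side b a `&` left_side a b)); last by rewrite setUC setUIDK.
  rewrite /area; apply: measureU0 => //.
    by apply: measurableI => //; apply: closed_measurable_plane; exact: closed_left_side.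
  apply: (subset_measure0 _ _ _ (area_line0 ab)).
  - by apply: measurableI => //; apply: closed_measurable_plane; exact: closed_left_side.
  - rewrite (_ : [set z | _] = left_side a b `&` left_side b a).
      by apply: closed_measurable_plane; apply: closedI; exact: closed_left_side.
    by apply/seteqP; split=> z; rewrite /left_side /det3 /=;
      [split; lra | case; lra].
  - by move=> z [[_]]; rewrite /left_side /det3 /=; lra.
rewrite {1}EK /area measureU //.
by apply/seteqP; split=> z // [[_ h] [_]].
Qed.

End Measure.

Section Triangle.
Variable R : realType.

Lemma integral_affine (a b p q : R) : p <= q ->
  (\int[lebesgue_measure]_(x in `[p, q]) (a + b * x)%:E =
   ((a + b * ((p + q) / 2)) * (q - p))%:E)%E.
Proof.
rewrite le_eqVlt => /predU1P[->|pq].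
  by rewrite set_itv1 integral_set1 subrr mulr0.
pose F x : R := a * x + b / 2 * (x * x).
have dF x : is_derive x (1 : R) F (a + b * x).
  by apply: is_derive_eq; rewrite /GRing.scale /=; field.
rewrite (@continuous_FTC2 R (fun x => a + b * x) F p q pq).
- by rewrite -EFinB; congr (_%:E); rewrite /F; field.
- apply: continuous_subspaceT => x; apply: cvgD; first exact: cvg_cst.
  by apply: cvgM; [exact: cvg_cst|exact: cvg_id].
- have cF x : {for x, continuous F}.
    by apply: differentiable_continuous; apply/derivable1_diffP; case: (dF x).
  split; first by move=> x _; case: (dF x).
    exact: cvg_at_right_filter (cF p).
  exact: cvg_at_left_filter (cF q).
- by move=> x _; rewrite derive1E; case: (dF x).
Qed.

Lemma area_between (A : set (plane R)) (p q f0 f1 g0 g1 : R) :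
  (forall z, A z <-> p <= z.1 <= q /\ f0 + f1 * z.1 <= z.2 <= g0 + g1 * z.1) ->
  p <= q -> (forall x, p <= x <= q -> f0 + f1 * x <= g0 + g1 * x) ->
  area A = ((g0 - f0 + (g1 - f1) * ((p + q) / 2)) * (q - p))%:E.
Proof.
move=> AE pq fg; rewrite -integral_affine // /area /product_measure1.
rewrite [RHS]integral_mkcond; apply: eq_integral => x _; rewrite patchE /=.
have sE y : xsection A x y = (p <= x <= q /\ f0 + f1 * x <= y <= g0 + g1 * x) :> Prop.
  by rewrite /xsection /= inE; apply/propext; exact: (AE (x, y)).
case: ifPn => [/set_mem|].
  rewrite /= in_itv /= => xpq; rewrite (_ : xsection A x = `[f0 + f1 * x, g0 + g1 * x]%classic).
    rewrite lebesgue_measure_itv /= lte_fin; case: ltrP => [_|gf].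
      by rewrite -EFinB; congr (_%:E); ring.
    by congr (_%:E); have := fg _ xpq; lra.
  by apply/seteqP; split=> y; rewrite sE /= in_itv /=; [case|].
rewrite notin_setE /= in_itv /= => xpq; rewrite (_ : xsection A x = set0) ?measure0 //.
by apply/seteqP; split=> y //; rewrite sE => -[].
Qed.

Lemma left_side_above (u v z : R * R) (k := (v.2 - u.2) / (v.1 - u.1)) : u.1 < v.1 ->
  (0 <= det3 u v z) = (u.2 - k * u.1 + k * z.1 <= z.2) /\
  (0 <= det3 v u z) = (z.2 <= u.2 - k * u.1 + k * z.1).
Proof.
move=> uv; have d0 : 0 < v.1 - u.1 by rewrite subr_gt0.
have kE : k * (v.1 - u.1) = v.2 - u.2 by rewrite /k divfK // gt_eqF.
have E1 : det3 u v z = (v.1 - u.1) * (z.2 - (u.2 - k * u.1 + k * z.1)).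
  transitivity ((v.1 - u.1) * (z.2 - u.2) - k * (v.1 - u.1) * (z.1 - u.1)); last by ring.
  by rewrite kE.
have E2 : det3 v u z = - det3 u v z by rewrite /det3; ring.
by split; rewrite ?E2 E1 ?oppr_ge0 ?pmulr_rge0 ?pmulr_rle0 // ?subr_ge0 ?subr_le0.
Qed.

(** The two sides at [a] have slopes differing by det3 a b c / ((b.1 - a.1) (c.1 - a.1)); half of
    that times the squared width is the area. *)
Lemma area_left_wedge (a b c : R * R) (m : R) : 0 < det3 a b c -> a.1 < b.1 ->
  a.1 < c.1 -> a.1 <= m ->
  area ([set z | [/\ 0 <= det3 a b z, 0 <= det3 c a z & z.1 <= m]] : set (plane R)) =
  ((m - a.1) ^+ 2 * det3 a b c / (2 * (b.1 - a.1) * (c.1 - a.1)))%:E.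
Proof.
move=> d0 ab ac am.
pose k := (b.2 - a.2) / (b.1 - a.1); pose l := (c.2 - a.2) / (c.1 - a.1).
have [b0 c0] : 0 < b.1 - a.1 /\ 0 < c.1 - a.1 by rewrite !subr_gt0.
have kl : l - k = det3 a b c / ((b.1 - a.1) * (c.1 - a.1)).
  by rewrite /k /l /det3; field; rewrite !gt_eqF.
have kl0 : 0 <= l - k by rewrite kl divr_ge0 ?mulr_ge0 // ltW.
rewrite (@area_between _ a.1 m (a.2 - k * a.1) k (a.2 - l * a.1) l) //.
- congr (_%:E); transitivity ((l - k) * (m - a.1) ^+ 2 / 2); first by field.
  by rewrite kl; field; rewrite !gt_eqF.
- move=> z; have [h1 _] := left_side_above z ab; have [_ h2] := left_side_above z ac.
  rewrite /= h1 h2 -/k -/l; split; last by case=> /andP[? ?] /andP[? ?].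
  case=> z1 z2 z3; split; last by apply/andP.
  rewrite z3 andbT -subr_ge0 -(pmulr_rge0 _ d0).
  rewrite (_ : _ * _ = det3 c a z * (b.1 - a.1) + det3 a b z * (c.1 - a.1)).
    by rewrite addr_ge0 // mulr_ge0 ?(ltW b0) ?(ltW c0) // ?h1 ?h2.
  by rewrite /det3; ring.
- move=> x /andP[ax _]; rewrite -subr_ge0.
  rewrite (_ : _ - _ = (l - k) * (x - a.1)); last by ring.
  by rewrite mulr_ge0 // subr_ge0.
Qed.

Lemma area_right_wedge (a b c : R * R) (m : R) : 0 < det3 a b c -> a.1 < b.1 ->
  c.1 < b.1 -> m <= b.1 ->
  area ([set z | [/\ 0 <= det3 a b z, 0 <= det3 b c z & m <= z.1]] : set (plane R)) =
  ((b.1 - m) ^+ 2 * det3 a b c / (2 * (b.1 - a.1) * (b.1 - c.1)))%:E.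
Proof.
move=> d0 ab cb mb.
pose k := (b.2 - a.2) / (b.1 - a.1); pose l := (b.2 - c.2) / (b.1 - c.1).
have [a0 c0] : 0 < b.1 - a.1 /\ 0 < b.1 - c.1 by rewrite !subr_gt0.
have kl : k - l = det3 a b c / ((b.1 - a.1) * (b.1 - c.1)).
  by rewrite /k /l /det3; field; rewrite !gt_eqF.
have kl0 : 0 <= k - l by rewrite kl divr_ge0 ?mulr_ge0 // ltW.
have kb : a.2 - k * a.1 = b.2 - k * b.1 by rewrite /k; field; rewrite gt_eqF.
have lb : c.2 - l * c.1 = b.2 - l * b.1 by rewrite /l; field; rewrite gt_eqF.
rewrite (@area_between _ m b.1 (b.2 - k * b.1) k (b.2 - l * b.1) l) //.
- congr (_%:E); transitivity ((k - l) * (b.1 - m) ^+ 2 / 2); first by field.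
  by rewrite kl; field; rewrite !gt_eqF.
- move=> z; have [h1 _] := left_side_above z ab; have [_ h2] := left_side_above z cb.
  rewrite /= h1 h2 -/k -/l kb lb; split; last by case=> /andP[? ?] /andP[? ?].
  case=> z1 z2 z3; split; last by apply/andP.
  rewrite z3 /= -subr_ge0 -(pmulr_rge0 _ d0).
  rewrite (_ : _ * _ = det3 a b z * (b.1 - c.1) + det3 b c z * (b.1 - a.1)).
    by rewrite addr_ge0 // mulr_ge0 ?(ltW a0) ?(ltW c0) // ?h1 ?h2 ?kb ?lb.
  by rewrite /det3; ring.
- move=> x /andP[_ xb]; rewrite -subr_ge0.
  rewrite (_ : _ - _ = (k - l) * (b.1 - x)); last by ring.
  by rewrite mulr_ge0 // subr_ge0.
Qed.

Definition triangle (a b c : R * R) : set (plane R) :=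
  left_side a b `&` left_side b c `&` left_side c a.

Lemma closed_triangle a b c : closed (triangle a b c).
Proof. by apply: closedI; [apply: closedI|]; exact: closed_left_side. Qed.

Lemma area_vertical_cut (K : set (plane R)) (m : R) : closed K ->
  area K = (area (K `&` [set z | z.1 <= m]%R) + area (K `&` [set z | m <= z.1]%R))%E.
Proof.
move=> cK; have ne : (m, 0) != (m, 1) :> R * R by rewrite xpair_eqE eqxx eq_sym oner_eq0.
have -> : [set z : plane R | z.1 <= m] = left_side (m, 0) (m, 1).
  by apply/seteqP; split=> z; rewrite /left_side /det3 /=; lra.
have -> : [set z : plane R | m <= z.1] = left_side (m, 1) (m, 0).
  by apply/seteqP; split=> z; rewrite /left_side /det3 /=; lra.
exact: area_cut.
Qed.

(** The vertical line through the vertex of middle abscissa cuts the triangle into two wedges, with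
    areas proportional to their widths. A vertical side makes one of them degenerate; it then lies
    in a vertical line. *)
Lemma area_triangle_leftmost (a b c : R * R) : a.1 <= b.1 -> a.1 <= c.1 ->
  0 < det3 a b c -> area (triangle a b c) = (det3 a b c / 2)%:E.
Proof.
move=> ab ac d0; have cT := @closed_triangle a b c.
have dE z : det3 a b c = det3 a b z + det3 b c z + det3 c a z by rewrite /det3; ring.
have [bc|cb] := lerP b.1 c.1.
- have {}ac : a.1 < c.1.
    rewrite lt_neqAle ac andbT; apply/eqP => E; have E' : a.1 = b.1 by lra.
    by move: d0; rewrite /det3 -E -E' !subrr !mul0r mulr0 subr0 ltxx.
  rewrite (area_vertical_cut b.1 cT).
  have -> : area (triangle a b c `&` [set z | z.1 <= b.1]) =
      ((b.1 - a.1) * det3 a b c / (2 * (c.1 - a.1)))%:E.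
    have [E|ab'] := eqVneq a.1 b.1.
      rewrite E subrr !mul0r (@area_vertical_line _ _ b.1) // => z [[[z1 z2] z3]] /= zb.
      apply/eqP; rewrite eq_le zb -E -subr_ge0 -(pmulr_rge0 _ d0).
      rewrite (_ : _ * _ = det3 c a z * (b.1 - a.1) + det3 a b z * (c.1 - a.1)).
        by apply: addr_ge0; apply: mulr_ge0;
          first [assumption | exact: ltW | rewrite subr_ge0 //; exact: ltW].
      by rewrite /det3; ring.
    have {ab'}ab' : a.1 < b.1 by rewrite lt_neqAle ab'.
    rewrite (_ : triangle a b c `&` _ =
      [set z | [/\ 0 <= det3 a b z, 0 <= det3 c a z & z.1 <= b.1]]); last first.
      apply/seteqP; split=> z /=; first by case=> -[[]].
      case=> z1 z2 z3; split=> //; split=> //; split=> //.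
      have b0 : 0 < b.1 - a.1 by rewrite subr_gt0.
      rewrite /left_side /= -(pmulr_rge0 _ b0).
      rewrite (_ : _ * _ = (c.1 - b.1) * det3 a b z + (b.1 - z.1) * det3 a b c).
        by apply: addr_ge0; apply: mulr_ge0;
          first [assumption | exact: ltW | rewrite subr_ge0 //; exact: ltW].
      by rewrite /det3; ring.
    rewrite area_left_wedge //; congr (_%:E); field.
    by rewrite !gt_eqF ?subr_gt0.
  have -> : area (triangle a b c `&` [set z | b.1 <= z.1]) =
      ((c.1 - b.1) * det3 a b c / (2 * (c.1 - a.1)))%:E.
    have [E|bc'] := eqVneq b.1 c.1.
      rewrite E subrr !mul0r (@area_vertical_line _ _ c.1) // => z [[[z1 z2] z3]] /= zb.
      apply/eqP; rewrite eq_le zb andbT -E -subr_ge0 -(pmulr_rge0 _ d0).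
      rewrite (_ : _ * _ = det3 b c z * (b.1 - a.1) + det3 c a z * (b.1 - b.1)).
        by apply: addr_ge0; apply: mulr_ge0;
          first [assumption | exact: ltW | rewrite subr_ge0 //; exact: ltW].
      by rewrite E /det3 -E; ring.
    have {bc'}bc' : b.1 < c.1 by rewrite lt_neqAle bc'.
    have dc : det3 b c a = det3 a b c by rewrite /det3; ring.
    rewrite (_ : triangle a b c `&` _ =
      [set z | [/\ 0 <= det3 b c z, 0 <= det3 c a z & b.1 <= z.1]]); last first.
      apply/seteqP; split=> z /=; first by case=> -[[]].
      case=> z1 z2 z3; split=> //; split=> //; split=> //.
      have b0 : 0 < c.1 - b.1 by rewrite subr_gt0.
      rewrite /left_side /= -(pmulr_rge0 _ b0).
      rewrite (_ : _ * _ = (b.1 - a.1) * det3 b c z + (z.1 - b.1) * det3 a b c).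
        by apply: addr_ge0; apply: mulr_ge0;
          first [assumption | exact: ltW | rewrite subr_ge0 //; exact: ltW].
      by rewrite /det3; ring.
    rewrite area_right_wedge ?dc //; congr (_%:E); field.
    by rewrite !gt_eqF ?subr_gt0.
  by rewrite -EFinD; congr (_%:E); field; rewrite gt_eqF ?subr_gt0.
- have {}ab : a.1 < b.1 by exact: le_lt_trans cb.
  rewrite (area_vertical_cut c.1 cT).
  have -> : area (triangle a b c `&` [set z | z.1 <= c.1]) =
      ((c.1 - a.1) * det3 a b c / (2 * (b.1 - a.1)))%:E.
    have [E|ac'] := eqVneq a.1 c.1.
      rewrite E subrr !mul0r (@area_vertical_line _ _ c.1) // => z [[[z1 z2] z3]] /= zb.
      apply/eqP; rewrite eq_le zb -E -subr_ge0 -(pmulr_rge0 _ d0).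
      rewrite (_ : _ * _ = det3 c a z * (b.1 - a.1) + det3 a b z * (c.1 - a.1)).
        by apply: addr_ge0; apply: mulr_ge0;
          first [assumption | exact: ltW | rewrite subr_ge0 //; exact: ltW].
      by rewrite /det3; ring.
    have {ac'}ac' : a.1 < c.1 by rewrite lt_neqAle ac'.
    rewrite (_ : triangle a b c `&` _ =
      [set z | [/\ 0 <= det3 a b z, 0 <= det3 c a z & z.1 <= c.1]]); last first.
      apply/seteqP; split=> z /=; first by case=> -[[]].
      case=> z1 z2 z3; split=> //; split=> //; split=> //.
      have b0 : 0 < c.1 - a.1 by rewrite subr_gt0.
      rewrite /left_side /= -(pmulr_rge0 _ b0).
      rewrite (_ : _ * _ = (b.1 - c.1) * det3 c a z + (c.1 - z.1) * det3 a b c).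
        by apply: addr_ge0; apply: mulr_ge0;
          first [assumption | exact: ltW | rewrite subr_ge0 //; exact: ltW].
      by rewrite /det3; ring.
    rewrite area_left_wedge //; congr (_%:E); field.
    by rewrite !gt_eqF ?subr_gt0.
  have -> : area (triangle a b c `&` [set z | c.1 <= z.1]) =
      ((b.1 - c.1) * det3 a b c / (2 * (b.1 - a.1)))%:E.
    rewrite (_ : triangle a b c `&` _ =
      [set z | [/\ 0 <= det3 a b z, 0 <= det3 b c z & c.1 <= z.1]]); last first.
      apply/seteqP; split=> z /=; first by case=> -[[]].
      case=> z1 z2 z3; split=> //; split=> //.
      have b0 : 0 < b.1 - c.1 by rewrite subr_gt0.
      rewrite /left_side /= -(pmulr_rge0 _ b0).
      rewrite (_ : _ * _ = (c.1 - a.1) * det3 b c z + (z.1 - c.1) * det3 a b c).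
        by apply: addr_ge0; apply: mulr_ge0;
          first [assumption | exact: ltW | rewrite subr_ge0 //; exact: ltW].
      by rewrite /det3; ring.
    rewrite area_right_wedge ?(ltW cb) //; congr (_%:E); field.
    by rewrite !gt_eqF ?subr_gt0.
  by rewrite -EFinD; congr (_%:E); field; rewrite gt_eqF ?subr_gt0.
Qed.

Lemma area_triangle (a b c : R * R) :
  0 < det3 a b c -> area (triangle a b c) = (det3 a b c / 2)%:E.
Proof.
move=> d0; have dE (u v w : R * R) : det3 v w u = det3 u v w by rewrite /det3; ring.
have tE u v w : triangle v w u = triangle u v w.
  by rewrite /triangle [LHS]setIC setIA.
have d1 : 0 < det3 b c a by rewrite dE.
have d2 : 0 < det3 c a b by rewrite dE.
have rot1 : b.1 <= c.1 -> b.1 <= a.1 -> area (triangle a b c) = (det3 a b c / 2)%:E.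
  by move=> bc ba; rewrite -(tE a b c) -(dE a b c); exact: area_triangle_leftmost.
have rot2 : c.1 <= a.1 -> c.1 <= b.1 -> area (triangle a b c) = (det3 a b c / 2)%:E.
  move=> ca cb; rewrite -(tE a b c) -(tE b c a) -(dE a b c) -(dE b c a).
  exact: area_triangle_leftmost.
have [ab|/ltW ba] := lerP a.1 b.1; have [ac|/ltW ca] := lerP a.1 c.1.
- exact: area_triangle_leftmost.
- by apply: rot2 => //; exact: le_trans ab.
- by apply: rot1 => //; exact: le_trans ac.
- by have [bc|/ltW cb] := lerP b.1 c.1; [exact: rot1|exact: rot2].
Qed.

End Triangle.

Section Polygon.
Variable R : realType.
Implicit Types K : set (plane R).

Lemma le_area (A B : set (plane R)) : closed A -> closed B -> A `<=` B ->
  (area A <= area B)%E.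
Proof.
move=> cA cB; have mA := closed_measurable_plane cA; have mB := closed_measurable_plane cB.
exact: (le_measure ((@lebesgue_measure R) \x (@lebesgue_measure R))%E (mem_set mA) (mem_set mB)).
Qed.

Lemma area_ge0 (A : set (plane R)) : (0 <= area A)%E.
Proof. by apply: integral_ge0. Qed.

Lemma convex_set3 K x y z (a b c : R) : convex_set K -> K x -> K y -> K z ->
  0 <= a -> 0 <= b -> 0 <= c -> a + b + c = 1 ->
  K (a * x.1 + b * y.1 + c * z.1, a * x.2 + b * y.2 + c * z.2).
Proof.
move=> cK Kx Ky Kz a0 b0 c0 abc; have [a1|a1] := ltrP a 1; last first.
  have [bE cE] : b = 0 /\ c = 0 by split; lra.
  have aE : a = 1 by lra.
  by rewrite aE bE cE !mul1r !mul0r !addr0 -surjective_pairing.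
have d0 : 0 < 1 - a by rewrite subr_gt0.
have bE : b / (1 - a) <= 1 by rewrite ler_pdivrMr // mul1r; lra.
have b1 : 0 <= b / (1 - a) <= 1 by rewrite bE divr_ge0 // ltW.
have Kw := convex_set_segment cK Ky Kz b1.
have a01 : 0 <= a <= 1 by rewrite a0 ltW.
have := convex_set_segment cK Kx Kw a01; congr (K (_, _)) => /=;
  rewrite (_ : c = 1 - a - b); try lra; field; exact: lt0r_neq0.
Qed.

Lemma convex_set4 K x y z t (a b c d : R) : convex_set K -> K x -> K y -> K z -> K t ->
  0 <= a -> 0 <= b -> 0 <= c -> 0 <= d -> a + b + c + d = 1 ->
  K (a * x.1 + b * y.1 + c * z.1 + d * t.1, a * x.2 + b * y.2 + c * z.2 + d * t.2).
Proof.
move=> cK Kx Ky Kz Kt a0 b0 c0 d0 abcd; have [a1|a1] := ltrP a 1; last first.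
  have [bE [cE dE]] : b = 0 /\ c = 0 /\ d = 0 by do !split; lra.
  have aE : a = 1 by lra.
  by rewrite aE bE cE dE !mul1r !mul0r !addr0 -surjective_pairing.
have e0 : 0 < 1 - a by rewrite subr_gt0.
have [b1 [c1 d1]] : 0 <= b / (1 - a) /\ 0 <= c / (1 - a) /\ 0 <= d / (1 - a).
  by do !split; rewrite divr_ge0 // ltW.
have bcd : b / (1 - a) + c / (1 - a) + d / (1 - a) = 1.
  by rewrite -!mulrDl (_ : b + c + d = 1 - a) ?divff ?gt_eqF //; lra.
have Kw := convex_set3 cK Ky Kz Kt b1 c1 d1 bcd.
have a01 : 0 <= a <= 1 by rewrite a0 ltW.
by have := convex_set_segment cK Kx Kw a01; congr (K (_, _)) => /=; field;
  exact: lt0r_neq0.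
Qed.

Lemma convex_left_side (a b : R * R) : convex_set (left_side a b : set (plane R)).
Proof.
move=> x y t; rewrite !inE => hx hy; rewrite /left_side /=.
set w := conv _ _ _.
have -> : det3 a b w = t%:num * det3 a b x + (1 - t%:num) * det3 a b y.
  have -> : w = (t%:num * x.1 + (1 - t%:num) * y.1, t%:num * x.2 + (1 - t%:num) * y.2) by [].
  by rewrite /det3 /=; ring.
by rewrite addr_ge0 // mulr_ge0 // subr_ge0.
Qed.

Lemma convex_setI K K' : convex_set K -> convex_set K' -> convex_set (K `&` K').
Proof.
move=> c1 c2 x y t; rewrite !inE => -[x1 x2] [y1 y2].
by split; apply: set_mem; [apply: c1|apply: c2]; exact: mem_set.
Qed.

Lemma triangle_sub K (a b c : R * R) : convex_set K -> K a -> K b -> K c ->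
  0 < det3 a b c -> triangle a b c `<=` K.
Proof.
move=> cK Ka Kb Kc d0 z [[z1 z2] z3].
have dE : det3 b c z + det3 c a z + det3 a b z = det3 a b c by rewrite /det3; ring.
have d1 := lt0r_neq0 d0.
pose w u := det3 b c z / det3 a b c * u a + det3 c a z / det3 a b c * u b +
  det3 a b z / det3 a b c * u c.
have -> : z = (w fst, w snd).
  rewrite [LHS]surjective_pairing /w; congr (_, _); apply: (mulIf d1);
    by rewrite !(mulrAC _ _^-1) -!mulrDl divfK // /det3; ring.
apply: convex_set3 => //; try (by apply: divr_ge0 => //; exact: ltW).
by rewrite -!mulrDl dE divff.
Qed.

Lemma inner_area_le K (c : R) : inner_area (K : set (R * R)) c -> closed K ->
  convex_set K -> (c%:E <= area K)%E.
Proof.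
elim=> {K c} [K a b c Ka Kb Kc|K a b c1 c2 ab _ IH1 _ IH2] cK vK.
  have [d0|d0] := ltrP 0 (det3 a b c).
    rewrite -area_triangle //; apply: le_area => //; first exact: closed_triangle.
    exact: triangle_sub.
  apply: le_trans (area_ge0 K); rewrite lee_fin; lra.
rewrite (area_cut cK ab) EFinD; apply: leeD; [apply: IH1|apply: IH2].
- by apply: closedI => //; exact: closed_left_side.
- by apply: convex_setI => //; exact: convex_left_side.
- by apply: closedI => //; exact: closed_left_side.
- by apply: convex_setI => //; exact: convex_left_side.
Qed.

Lemma circumscribed_hull K (v1 v2 v3 v4 : R * R) :
  circumscribed (K : set (R * R)) v1 v2 v3 v4 ->
  K `<=` convex_hull [set` [:: v1; v2; v3; v4]] /\
  (area (convex_hull [set` [:: v1; v2; v3; v4]]) <= (quad_det v1 v2 v3 v4 / 2)%:E)%E.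
Proof.
move=> cir; pose P : set (plane R) :=
  left_side v1 v2 `&` left_side v2 v3 `&` left_side v3 v4 `&` left_side v4 v1.
have cP : closed P by do !apply: closedI; exact: closed_left_side.
have vP : convex_set P by do !apply: convex_setI; exact: convex_left_side.
have KP : K `<=` P.
  case: cir => _ _ _ _ s1 s2 s3 s4 _ z Kz.
  by split; [split; [split|]|]; [exact: s1|exact: s2|exact: s3|exact: s4].
have [t1 t2 t3 t4 _ _ _ _ q] := cir.
(* [P] is circumscribed by its own vertices, so every point of it is a convex combination of
   them. *)
have cirP : circumscribed (P : set (R * R)) v1 v2 v3 v4.
  by split=> //; [move=> z [[[]]]|move=> z [[[]]]|move=> z [[]]|move=> z []].
have hullE : convex_hull [set` [:: v1; v2; v3; v4]] = P.
  apply/seteqP; split.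
    apply: smallest_sub => // z /=; rewrite !inE.
    have d0 (u w : R * R) : 0 <= det3 u w u /\ 0 <= det3 u w w.
      by rewrite /det3; split; rewrite le_eqVlt; apply/orP; left; apply/eqP; ring.
    have cyc (u v w : R * R) : 0 <= det3 u v w -> 0 <= det3 v w u.
      by move=> h; rewrite (_ : det3 v w u = det3 u v w) // /det3; ring.
    case/or4P => /eqP ->; rewrite /P /left_side /=; (split; [split; [split|]|]);
      rewrite ?(d0 _ _).1 ?(d0 _ _).2 //; do ?exact: cyc; do ?(apply: cyc; exact: cyc).
  move=> z /(circumscribed_barycentric cirP)[a [b [c [d [[a0 b0 c0 d0] [abcd z1 z2]]]]]].
  move=> A [cA vA]; rewrite [z]surjective_pairing z1 z2.
  by apply: convex_set4 => //; apply: vA; rewrite /= !inE eqxx ?orbT.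
rewrite hullE; split=> //.
have v13 : v1 != v3.
  apply: contraTneq q => <-; rewrite /quad_det !subrr !mul0r subrr.
  by rewrite ltxx.
rewrite (area_cut cP v13).
have -> : quad_det v1 v2 v3 v4 / 2 = det3 v1 v3 v4 / 2 + det3 v1 v2 v3 / 2.
  by rewrite /quad_det /det3; ring.
have cL u w : closed (P `&` left_side u w) by apply: closedI => //; exact: closed_left_side.
have t31 : det3 v1 v3 v4 = det3 v3 v4 v1 by rewrite /det3; ring.
have line_le (u w : R * R) (r : R) : u != w -> r = 0 ->
    P `&` left_side u w `<=` [set z | det3 u w z = 0] ->
    (area (P `&` left_side u w) <= r%:E)%E.
  move=> uw -> sub; apply: (@le_trans _ _ (area [set z | det3 u w z = 0])).
    2: by rewrite area_line0.
  apply: le_area => //.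
  rewrite (_ : [set z | _] = left_side u w `&` left_side w u).
    by apply: closedI; exact: closed_left_side.
  by apply/seteqP; split=> z; rewrite /left_side /det3 /=; [split; lra | case; lra].
rewrite EFinD; apply: leeD.
- have [d0|d0] := ltrP 0 (det3 v1 v3 v4).
    rewrite -area_triangle //; apply: le_area => //; first exact: closed_triangle.
    by move=> z [[[[z1 z2] z3] z4] z5]; split; [split|].
  have d1 : det3 v1 v3 v4 = 0 by apply/eqP; rewrite eq_le d0 t31.
  apply: line_le; rewrite ?d1 ?mul0r // => z [[[[z1 z2] z3] z4] z5] /=.
  have : det3 v1 v3 z + det3 v3 v4 z + det3 v4 v1 z = 0 by rewrite -d1 /det3; ring.
  by move: z3 z4 z5; rewrite /left_side /=; lra.
- rewrite eq_sym in v13; have [d0|d0] := ltrP 0 (det3 v1 v2 v3).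
    rewrite -area_triangle //; apply: le_area => //; first exact: closed_triangle.
    by move=> z [[[[z1 z2] z3] z4] z5]; split; [split|].
  have d1 : det3 v1 v2 v3 = 0 by apply/eqP; rewrite eq_le d0.
  apply: line_le; rewrite ?d1 ?mul0r // => z [[[[z1 z2] z3] z4] z5] /=.
  have : det3 v1 v2 z + det3 v2 v3 z + det3 v3 v1 z = 0 by rewrite -d1 /det3; ring.
  by move: z1 z2 z5; rewrite /left_side /=; lra.
Qed.

End Polygon.

(** * From the algebraic bound to areas of convex bodies *)

Lemma inner_area_square (R : realType) (K : set (plane R)) : K° !=set0 ->
  exists2 c : R, 0 < c & inner_area (K : set (R * R)) c.
Proof.
case/interior_square => p [r r0 Kp].
exists (det3 (p.1 - r, p.2 - r) (p.1 + r, p.2 - r) (p.1, p.2 + r) / 2).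
  rewrite divr_gt0 // (_ : det3 _ _ _ = 4 * r ^+ 2); last by rewrite /det3 /=; ring.
  by rewrite mulr_gt0 // exprn_gt0.
have r1 : `|r| <= r by rewrite gtr0_norm.
have r2 : `|- r| <= r by rewrite normrN.
apply: inner_triangle; [exact: Kp|exact: Kp|].
by rewrite -[p.1]addr0; apply: Kp => //; rewrite normr0 ltW.
Qed.

Theorem theorem1p1 (R : realType) (K : set (plane R)) :
  convex_body K ->
  exists Q : set (plane R),
    [/\ quadrangle Q, K `<=` Q &
      (area Q < ((1 - 26 / 10 * 10 ^- 7) * Num.sqrt 2)%:E * area K)%E].
Proof.
case=> cK vK iK; apply: contrapT => noQ.
have clK : closed K by apply: compact_closed => //; exact: norm_hausdorff.
have K0 : K !=set0 by case: iK => x /interior_subset Kx; exists x.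
set kap := (1 - _) * _ in noQ.
have e7 : 26 / 10 * 10 ^- 7 <= 26 / 100 / 1000 / 1000 :> R.
  rewrite (_ : 10 ^- 7 = 1 / 10 / 1000 / 1000) ?lexx; last by field.
  lra.
have e7' : 0 <= 26 / 10 * 10 ^- 7 :> R by rewrite mulr_ge0 ?invr_ge0 ?exprn_ge0.
have s0 : 0 < Num.sqrt 2 :> R by rewrite sqrtr_gt0.
have s2 : Num.sqrt 2 ^+ 2 = 2 :> R by rewrite sqr_sqrtr.
have kap0 : 0 < kap by rewrite mulr_gt0 //; lra.
have kap_le v1 v2 v3 v4 : circumscribed (K : set (R * R)) v1 v2 v3 v4 ->
    (kap%:E * area K <= (quad_det v1 v2 v3 v4 / 2)%:E)%E.
  move=> cir; have [KQ Qq] := circumscribed_hull cir.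
  rewrite leNgt; apply/negP => lt_kap; apply: noQ.
  exists (convex_hull [set` [:: v1; v2; v3; v4]]); split=> //.
    by exists [:: v1; v2; v3; v4].
  exact: le_lt_trans lt_kap.
(* An infinite area would contradict [kap_le] for any circumscribed quadrangle, whose determinant is
   finite. *)
have Afin : area K \is a fin_num.
  rewrite ge0_fin_numE ?area_ge0 //.
  have [v1 [v2 [v3 [v4 cir]]]] := circumscribed_exists cK.
  rewrite ltey; apply/eqP => AE; have := kap_le _ _ _ _ cir.
  by rewrite AE gt0_muley ?lte_fin // leye_eq.
pose A := fine (area K).
have AE : area K = A%:E by rewrite fineK.
have maxA c : inner_area (K : set (R * R)) c -> c <= A.
  by move=> /inner_area_le /(_ clK vK); rewrite AE lee_fin.
have A0 : 0 < A.
  by have [c c0 /maxA] := inner_area_square iK; exact: lt_le_trans.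
have {}kap_le v1 v2 v3 v4 : circumscribed (K : set (R * R)) v1 v2 v3 v4 ->
    2 * (kap * A) <= quad_det v1 v2 v3 v4.
  by move/kap_le; rewrite AE -EFinM lee_fin ler_pdivlMr // mulrC.
have c0 : 0 < 2 * (kap * A) by apply: mulr_gt0 => //; exact: mulr_gt0.
have [v1 [v2 [v3 [v4 [cir vmin]]]]] := min_quad_exists cK iK c0 kap_le.
(* eps = 10^-6 is the largest value allowed by [min_quad_area]. The contradiction needs (1 + eps) (1
   - 2.6 * 10^-7) >= 1, which holds with room to spare. *)
have eps0 : 0 <= 1 / 1000 / 1000 :> R by lra.
have := min_quad_area (compact_attains_max cK K0) (compact_convex_separated cK K0 vK)
  cir vmin maxA (ltW s0) s2 eps0 (lexx _).
apply/negP; rewrite -leNgt.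
have e0 : 0 <= Num.sqrt 2 / 2 * (1 + 1 / 1000 / 1000) :> R.
  by apply: mulr_ge0; [apply: divr_ge0 => //; exact: ltW | lra].
apply: (@le_trans _ _ (Num.sqrt 2 / 2 * (1 + 1 / 1000 / 1000) * (kap * A))); last first.
  by apply: ler_wpM2l => //; rewrite ler_pdivlMr // mulrC; exact: kap_le.
have -> : Num.sqrt 2 / 2 * (1 + 1 / 1000 / 1000) * (kap * A) =
    Num.sqrt 2 ^+ 2 / 2 * ((1 + 1 / 1000 / 1000) * (1 - 26 / 10 * 10 ^- 7)) * A.
  by rewrite /kap; ring.
rewrite s2 divff // mul1r ler_pMl //.
move: e7 e7'; set e := 26 / 10 * 10 ^- 7; clearbody e => e7 e7'.
have : 1 / 1000 / 1000 * e <= 1 / 1000 / 1000 * (1 / 1000) by apply: ler_wpM2l => //; lra.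
lra.
Qed.
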